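(* Let $A$ be an ordinary (ungraded) ring and let $d\in\{1,2,\ldots\}\cup\{\infty\}$. Let $\rho$ be a normalized $d$-periodic rank function on $\operatorname{Perf}(A)$. Then the restriction of $\rho$ to morphisms of $\operatorname{proj}(A)$ (regarded as a full subcategory of $\operatorname{Perf}(A)$ via complexes concentrated in degree $0$) takes values in $\mathbb{R}_{\geq 0}$ and is a Sylvester morphism rank function on $A$. In the case $d=\infty$, this restriction determines a bijection between normalized $\infty$-periodic rank functions on $\operatorname{Perf}(A)$ and Sylvester morphism rank functions on $A$.
   Context: $\operatorname{Perf}(A)$ is the perfect derived category of (right) $A$-modules, a triangulated category with translation functor $\Sigma$; $\operatorname{proj}(A)$ is the category of finitely generated projective right $A$-modules. For $d\in\{1,2,\ldots\}\cup\{\infty\}$ let $\mathbb{R}(d)=\mathbb{R}[q,q^{-1}]$ if $d=\infty$ and $\mathbb{R}(d)=\mathbb{R}[q]/(q^d-1)$ if $d<\infty$; let $\mathbb{R}_{\geq0}(d)$ be the set of elements represented by (Laurent) polynomials with nonnegative coefficients; write $\phi\geq\psi$ if $\phi-\psi\in\mathbb{R}_{\geq0}(d)$. Real numbers are regarded as constants in $\mathbb{R}(d)$. A $d$-periodic rank function on a triangulated category $\mathcal{C}$ assigns to each morphism $f$ an element $\rho(f)\in\mathbb{R}_{\geq0}(d)$ such that: (i) $\rho(\Sigma f)=q\rho(f)$; (ii) $\rho(f\oplus g)=\rho(f)+\rho(g)$; (iii) for every exact triangle $X\xrightarrow{f}Y\xrightarrow{g}Z\rightsquigarrow$, $\rho(f)+\rho(g)=\rho(\mathrm{id}_Y)$;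 (iv) for morphisms $f:X\to Y$, $g:Z\to W$, $h:Z\to Y$, the morphism $\begin{pmatrix} f&h\\0&g\end{pmatrix}:X\oplus Z\to Y\oplus W$ has rank $\geq\rho(f)+\rho(g)$; (v) $\rho(gf)\leq\rho(f)$ and $\rho(gf)\leq\rho(g)$ whenever $gf$ is defined. One writes $\rho(X)=\rho(\mathrm{id}_X)$; $\rho$ is normalized if $\rho(A)=1$. A Sylvester morphism rank function on $A$ assigns to each morphism $f$ of $\operatorname{proj}(A)$ a real number $\rho(f)\geq 0$ such that: $\rho(\mathrm{id}_A)=1$; $\rho(f\oplus g)=\rho(f)+\rho(g)$; $\rho\begin{pmatrix} f&h\\0&g\end{pmatrix}\geq\rho(f)+\rho(g)$ whenever defined (with $g,h$ sharing domain and $f,h$ sharing codomain); and $\rho(gf)\leq\rho(f)$, $\rho(gf)\leq\rho(g)$ whenever $gf$ is defined. *)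

(* Defs.v *)
(* Perf(A) is modelled by its standard equivalent K^b(proj A):
   bounded cochain complexes of f.g. projective right A-modules modulo homotopy.
   A f.g. projective right A-module is modelled as e A^n (column vectors) for an
   idempotent n x n matrix e; a module map e A^n -> f A^m is an m x n matrix M
   with M = f M e (acting by left multiplication). *)
From HB Require Import structures.
From mathcomp Require Import all_boot all_order all_algebra.
From mathcomp Require Import reals.
Set Implicit Arguments.
Unset Strict Implicit.
Unset Printing Implicit Defensive.
Import Order.TTheory GRing.Theory Num.Theory.
Local Open Scope ring_scope.

Inductive period := Fin of nat | Infty.
Definition valid_period (d : period) : Prop :=
  match d with Fin n => (0 < n)%N | Infty => True end.

Section RankFunctions.
Variable R : realType.
Variable A : pzRingType.

(* An element of R(d) is represented by its coefficient function int -> R: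
   for d = oo a finitely supported function (Laurent polynomial, coefficient of q^k at k);
   for finite d a d-periodic function (coefficient of q^(k mod d) in R[q]/(q^d-1)). *)
Definition inRd (d : period) (c : int -> R) : Prop :=
  match d with
  | Fin n => forall k : int, c (k + n%:Z) = c k
  | Infty => exists N : nat, forall k : int, (N < `|k|)%N -> c k = 0
  end.
Definition Rge0 (c : int -> R) : Prop := forall k, 0 <= c k.
Definition qmul (c : int -> R) : int -> R := fun k => c (k - 1).
Definition cadd (c1 c2 : int -> R) : int -> R := fun k => c1 k + c2 k.
Definition cle (c1 c2 : int -> R) : Prop := forall k, c1 k <= c2 k.
Definition cst (d : period) (r : R) : int -> R := fun k =>
  match d with
  | Fin n => if (n%:Z %| k)%Z then r else 0
  | Infty => if k == 0 then r else 0
  end.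

Record pobj := Pobj { pn : nat; pe : 'M[A]_pn }.
Definition is_pobj (P : pobj) : Prop := pe P *m pe P = pe P.
Definition pmor (P Q : pobj) := 'M[A]_(pn Q, pn P).
Definition is_pmor (P Q : pobj) (m : pmor P Q) : Prop := m = pe Q *m m *m pe P.
Definition pid (P : pobj) : pmor P P := pe P.
Definition pcomp (P Q S : pobj) (g : pmor Q S) (f : pmor P Q) : pmor P S := g *m f.
Definition Aobj : pobj := @Pobj 1%N 1%:M.
Definition psum (P Q : pobj) : pobj :=
  @Pobj (pn P + pn Q)%N (block_mx (pe P) 0 0 (pe Q)).
Definition ptri (P Q S T : pobj) (f : pmor P Q) (h : pmor S Q) (g : pmor S T)
  : pmor (psum P S) (psum Q T) := block_mx f h 0 g.
Definition psumm (P Q S T : pobj) (f : pmor P Q) (g : pmor S T)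
  : pmor (psum P S) (psum Q T) := block_mx f 0 0 g.

Definition sylrank := forall P Q : pobj, pmor P Q -> R.

Definition is_sylvester (s : sylrank) : Prop :=
  (forall P Q (f : pmor P Q), is_pobj P -> is_pobj Q -> is_pmor f -> 0 <= s P Q f) /\
  s Aobj Aobj (pid Aobj) = 1 /\
  (forall P Q S T (f : pmor P Q) (g : pmor S T),
      is_pobj P -> is_pobj Q -> is_pobj S -> is_pobj T -> is_pmor f -> is_pmor g ->
      s _ _ (psumm f g) = s _ _ f + s _ _ g) /\
  (forall P Q S T (f : pmor P Q) (h : pmor S Q) (g : pmor S T),
      is_pobj P -> is_pobj Q -> is_pobj S -> is_pobj T ->
      is_pmor f -> is_pmor h -> is_pmor g ->
      s _ _ f + s _ _ g <= s _ _ (ptri f h g)) /\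
  (forall P Q S (f : pmor P Q) (g : pmor Q S),
      is_pobj P -> is_pobj Q -> is_pobj S -> is_pmor f -> is_pmor g ->
      s _ _ (pcomp g f) <= s _ _ f /\ s _ _ (pcomp g f) <= s _ _ g).

(* cochain complex: X^i = ce i A^(cn i), differential cd i : X^i -> X^(i+1) *)
Record cplx := Cplx {
  cn : int -> nat;
  ce : forall i, 'M[A]_(cn i);
  cd : forall i, 'M[A]_(cn (i + 1), cn i) }.

Definition is_cplx (X : cplx) : Prop :=
  (exists N : nat, forall i : int, (N < `|i|)%N -> cn X i = 0%N) /\
  (forall i, ce X i *m ce X i = ce X i) /\
  (forall i, cd X i = ce X (i + 1) *m cd X i *m ce X i) /\
  (forall i, cd X (i + 1) *m cd X i = 0).

Definition cmor (X Y : cplx) := forall i, 'M[A]_(cn Y i, cn X i).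

Definition is_chain (X Y : cplx) (f : cmor X Y) : Prop :=
  (forall i, f i = ce Y i *m f i *m ce X i) /\
  (forall i, f (i + 1) *m cd X i = cd Y i *m f i).

Definition homotopic (X Y : cplx) (f g : cmor X Y) : Prop :=
  exists h : forall i, 'M[A]_(cn Y i, cn X (i + 1)),
    (forall i, h i = ce Y i *m h i *m ce X (i + 1)) /\
    (forall i, f (i + 1) - g (i + 1) = cd Y i *m h i + h (i + 1) *m cd X (i + 1)).

Definition cid (X : cplx) : cmor X X := fun i => ce X i.
Definition ccomp (X Y Z : cplx) (g : cmor Y Z) (f : cmor X Y) : cmor X Z :=
  fun i => g i *m f i.

Definition is_iso (X Y : cplx) (a : cmor X Y) : Prop :=
  is_chain a /\ exists b : cmor Y X, is_chain b /\
    homotopic (ccomp b a) (cid X) /\ homotopic (ccomp a b) (cid Y).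

Definition shift (X : cplx) : cplx :=
  @Cplx (fun i => cn X (i + 1)) (fun i => ce X (i + 1)) (fun i => - cd X (i + 1)).
Definition shiftm (X Y : cplx) (f : cmor X Y) : cmor (shift X) (shift Y) :=
  fun i => f (i + 1).

Definition csum (X Y : cplx) : cplx :=
  @Cplx (fun i => cn X i + cn Y i)%N
        (fun i => block_mx (ce X i) 0 0 (ce Y i))
        (fun i => block_mx (cd X i) 0 0 (cd Y i)).
Definition csumm (X Y Z W : cplx) (f : cmor X Y) (g : cmor Z W)
  : cmor (csum X Z) (csum Y W) := fun i => block_mx (f i) 0 0 (g i).
Definition ctri (X Y Z W : cplx) (f : cmor X Y) (h : cmor Z Y) (g : cmor Z W)
  : cmor (csum X Z) (csum Y W) := fun i => block_mx (f i) (h i) 0 (g i).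

Definition cone (X Y : cplx) (f : cmor X Y) : cplx :=
  @Cplx (fun i => cn X (i + 1) + cn Y i)%N
        (fun i => block_mx (ce X (i + 1)) 0 0 (ce Y i))
        (fun i => block_mx (- cd X (i + 1)) 0 (f (i + 1)) (cd Y i)).
Definition cone_in (X Y : cplx) (f : cmor X Y) : cmor Y (cone f) :=
  fun i => col_mx 0 (ce Y i).
Definition cone_out (X Y : cplx) (f : cmor X Y) : cmor (cone f) (shift X) :=
  fun i => row_mx (ce X (i + 1)) 0.

Definition exact_tri (X Y Z : cplx) (u : cmor X Y) (v : cmor Y Z) (w : cmor Z (shift X))
  : Prop :=
  is_chain u /\ is_chain v /\ is_chain w /\
  exists (X' Y' : cplx) (f : cmor X' Y') (a : cmor X X') (b : cmor Y Y')
         (c : cmor Z (cone f)),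
    is_cplx X' /\ is_cplx Y' /\ is_chain f /\ is_iso a /\ is_iso b /\ is_iso c /\
    homotopic (ccomp b u) (ccomp f a) /\
    homotopic (ccomp c v) (ccomp (cone_in f) b) /\
    homotopic (ccomp (shiftm a) w) (ccomp (cone_out f) c).

(* a function on morphisms (chain maps, required to be constant on homotopy classes) *)
Definition rankfun := forall X Y : cplx, cmor X Y -> int -> R.

Definition is_rankfun (d : period) (rho : rankfun) : Prop :=
  (forall X Y (f : cmor X Y), is_cplx X -> is_cplx Y -> is_chain f ->
      inRd d (rho X Y f) /\ Rge0 (rho X Y f)) /\
  (forall X Y (f g : cmor X Y), is_cplx X -> is_cplx Y -> is_chain f -> is_chain g ->
      homotopic f g -> rho X Y f =1 rho X Y g) /\
  (forall X Y (f : cmor X Y), is_cplx X -> is_cplx Y -> is_chain f ->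
      rho _ _ (shiftm f) =1 qmul (rho X Y f)) /\
  (forall X Y Z W (f : cmor X Y) (g : cmor Z W),
      is_cplx X -> is_cplx Y -> is_cplx Z -> is_cplx W -> is_chain f -> is_chain g ->
      rho _ _ (csumm f g) =1 cadd (rho _ _ f) (rho _ _ g)) /\
  (forall X Y Z (u : cmor X Y) (v : cmor Y Z) (w : cmor Z (shift X)),
      is_cplx X -> is_cplx Y -> is_cplx Z -> exact_tri u v w ->
      cadd (rho _ _ u) (rho _ _ v) =1 rho _ _ (cid Y)) /\
  (forall X Y Z W (f : cmor X Y) (h : cmor Z Y) (g : cmor Z W),
      is_cplx X -> is_cplx Y -> is_cplx Z -> is_cplx W ->
      is_chain f -> is_chain h -> is_chain g ->
      cle (cadd (rho _ _ f) (rho _ _ g)) (rho _ _ (ctri f h g))) /\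
  (forall X Y Z (f : cmor X Y) (g : cmor Y Z),
      is_cplx X -> is_cplx Y -> is_cplx Z -> is_chain f -> is_chain g ->
      cle (rho _ _ (ccomp g f)) (rho _ _ f) /\ cle (rho _ _ (ccomp g f)) (rho _ _ g)).

Definition deg0 (P : pobj) : cplx :=
  @Cplx (fun i => if i == 0 then pn P else 0%N)
        (fun i => if i == 0 as b return 'M[A]_(if b then pn P else 0%N) then pe P else 0)
        (fun i => 0).
Definition deg0m (P Q : pobj) (m : pmor P Q) : cmor (deg0 P) (deg0 Q) :=
  fun i => if i == 0 as b return 'M[A]_(if b then pn Q else 0%N, if b then pn P else 0%N)
           then m else 0.

Definition normalized (d : period) (rho : rankfun) : Prop :=
  rho _ _ (cid (deg0 Aobj)) =1 cst d 1.

(* restriction of rho to proj(A): the (constant) coefficient of q^0 *)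
Definition restr (rho : rankfun) : sylrank := fun P Q m => rho _ _ (deg0m m) 0.

End RankFunctions.

(* Main.v *)
(* A Sylvester rank function is determined by its values [r] on matrices.  Over a
   field, the rank of [H^i f] is
     [r ((d_X^i, 0), (f^i, d_Y^(i-1))) - r (d_X^i) - r (d_Y^(i-1))],
   and for a general Sylvester rank the same formula defines a rank function on
   complexes: every axiom becomes an elimination between block matrices.

   Conversely, rotating the triangle of [f : X -> Y] gives
     [(1 + q) rho f = rho Y - rho (cone f) + q rho X],
   and [1 + q] is injective on Laurent polynomials, so [rho] is determined by its
   values on objects.  Splitting off the lowest term [X^a] of [X] reduces these to
   the rank of the connecting map [X^a -> shift (X^(>a))]; that rank is
   concentrated in one power of [q], where by Frobenius' inequality it agrees with
   the rank of the differential out of [X^a]. *)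

Require Import Defs.
From HB Require Import structures.
From mathcomp Require Import all_boot all_order all_algebra.
From mathcomp Require Import reals zify lra.
Import Order.TTheory GRing.Theory Num.Theory.
Local Open Scope ring_scope.
Set Implicit Arguments.
Unset Strict Implicit.
Unset Printing Implicit Defensive.

(** * Ranks of matrices *)


Definition mxblockE := (mulmx_block, mul_row_block, mul_block_col, mul_row_col,
  mul_col_row, mul_mx_row, mul_col_mx).
Definition mxunitE := (mulmx0, mul0mx, mulmx1, mul1mx, addr0, add0r, subr0, sub0r,
  oppr0, @opprK, mulmxN, mulNmx, row_mx0, col_mx0, block_mx0).

Definition mxaddE := (add_row_mx, add_block_mx, add_col_mx, opp_row_mx, opp_col_mx,
  opp_block_mx).

Lemma col_mx0_block (V : nmodType) m1 m2 m3 n1 n2 (a : 'M[V]_(m1, n1))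
    (b : 'M_(m1, n2)) (c : 'M_(m2, n1)) (d : 'M_(m2, n2)) :
  col_mx (0 : 'M_(m3, _)) (block_mx a b c d) = block_mx 0 0 (col_mx a c) (col_mx b d).
Proof. by rewrite block_mxEh /block_mx row_mx0. Qed.

Section MatrixRank.
Variables (R : realType) (A : pzRingType).
Implicit Types m n p : nat.

(* The values of a Sylvester rank function on maps of free modules determine it,
   since M = f M e factors through the free modules containing the summands. *)
Definition is_mxrank (r : forall m n, 'M[A]_(m, n) -> R) : Prop :=
  [/\ forall m n (a : 'M_(m, n)), 0 <= r m n a,
      r 1%N 1%N 1%:M = 1,
      forall m n p q (a : 'M_(m, n)) (b : 'M_(p, q)),
        r _ _ (block_mx a 0 0 b) = r _ _ a + r _ _ b,
      forall m n p q (a : 'M_(m, n)) (b : 'M_(p, q)) c,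
        r _ _ a + r _ _ b <= r _ _ (block_mx a c 0 b)
    & forall m n p (a : 'M_(m, n)) (b : 'M_(n, p)),
        r _ _ (a *m b) <= r _ _ a /\ r _ _ (a *m b) <= r _ _ b].

Definition freeobj n : pobj A := Pobj (1%:M : 'M[A]_n).

Definition mxrank_of (s : sylrank R A) m n (a : 'M[A]_(m, n)) : R :=
  s (freeobj n) (freeobj m) a.

Lemma freeobjP n : is_pobj (freeobj n).
Proof. by rewrite /is_pobj /= mul1mx. Qed.

Lemma free_pmor m n (a : 'M[A]_(m, n)) : @is_pmor _ (freeobj n) (freeobj m) a.
Proof. by rewrite /is_pmor /= mul1mx mulmx1. Qed.

Section OfSylvester.
Variable s : sylrank R A.
Hypothesis sS : is_sylvester s.

(** [pe P] is both the projection of a free module onto [P] and the inclusion back, so [a] between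
    the summands and [a] between the free modules factor through each other. *)
Lemma mxrank_ofE (P Q : pobj A) (a : pmor P Q) :
  is_pobj P -> is_pobj Q -> is_pmor a -> s a = mxrank_of s a.
Proof.
case: sS => [_ [_ [_ [_ sM]]]] hP hQ ha.
have iP : @is_pmor _ (freeobj (pn P)) P (pe P) by rewrite /is_pmor /= mulmx1 hP.
have jP : @is_pmor _ P (freeobj (pn P)) (pe P) by rewrite /is_pmor /= mul1mx hP.
have iQ : @is_pmor _ (freeobj (pn Q)) Q (pe Q) by rewrite /is_pmor /= mulmx1 hQ.
have jQ : @is_pmor _ Q (freeobj (pn Q)) (pe Q) by rewrite /is_pmor /= mul1mx hQ.
have fP := freeobjP (pn P); have fQ := freeobjP (pn Q).
have fa := free_pmor a.
have la : pe Q *m a = a by rewrite [in RHS]ha [in LHS]ha !mulmxA hQ.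
have ra : a *m pe P = a by rewrite [in RHS]ha [in LHS]ha -!mulmxA hP.
have ba : @is_pmor _ (freeobj (pn P)) Q a by rewrite /is_pmor /= mulmx1 la.
have ca : @is_pmor _ P (freeobj (pn Q)) a by rewrite /is_pmor /= mul1mx ra.
apply/eqP; rewrite eq_le; apply/andP; split.
  have := (sM _ _ _ _ _ hP fP hQ jP ba).2; rewrite /Defs.pcomp /= ra => /le_trans; apply.
  by have := (sM _ _ _ _ _ fP fQ hQ fa iQ).1; rewrite /Defs.pcomp /= la.
have := (sM _ _ _ _ _ fP hP fQ iP ca).2; rewrite /Defs.pcomp /= ra => /le_trans; apply.
by have := (sM _ _ _ _ _ hP hQ fQ ha jQ).1; rewrite /Defs.pcomp /= la.
Qed.

Lemma mxrank_ofP : is_mxrank (mxrank_of s).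
Proof.
case: (sS) => [s0 [s1 [sD [sT sM]]]]; split=> [m n a||m n p q a b|m n p q a b c|m n p a b].
- by apply: s0; [exact: freeobjP..|exact: free_pmor].
- exact: s1.
- have := sD _ _ _ _ _ _ (freeobjP n) (freeobjP m) (freeobjP q) (freeobjP p)
    (free_pmor a) (free_pmor b).
  rewrite /psumm /mxrank_of /psum /= => <-.
  (* An identity matrix is block diagonal, so the sum of two free objects is literally free. *)
  by rewrite /freeobj -!(scalar_mx_block _ _ 1).
- have := sT _ _ _ _ _ _ _ (freeobjP n) (freeobjP m) (freeobjP q) (freeobjP p)
    (free_pmor a) (free_pmor c) (free_pmor b).
  by rewrite /ptri /mxrank_of /psum /= /freeobj -!(scalar_mx_block _ _ 1).
- by have [] := sM _ _ _ _ _ (freeobjP p) (freeobjP n) (freeobjP m) (free_pmor b) (free_pmor a).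
Qed.

End OfSylvester.

Variable r : forall m n, 'M[A]_(m, n) -> R.
Arguments r {m n}.
Hypothesis rP : is_mxrank (@r).

Lemma mxrank_ge0 m n (a : 'M_(m, n)) : 0 <= r a. Proof. by case: rP. Qed.
Lemma mxrank_diag m n p q (a : 'M_(m, n)) (b : 'M_(p, q)) :
  r (block_mx a 0 0 b) = r a + r b.
Proof. by case: rP. Qed.
Lemma mxrank_ut m n p q (a : 'M_(m, n)) (b : 'M_(p, q)) c :
  r a + r b <= r (block_mx a c 0 b).
Proof. by case: rP. Qed.

Lemma mxrank_factor m n m' n' (a : 'M_(m, n)) (u : 'M_(m', m)) (v : 'M_(n, n')) b :
  b = u *m a *m v -> r b <= r a.
Proof.
case: rP => [_ _ _ _ rM] ->.
by apply: le_trans (rM _ _ _ _ _).1 _; exact: (rM _ _ _ _ _).2.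
Qed.

(** Factorizations in both directions certify equal ranks even for matrices of different sizes, with
    no inverses to exhibit. *)
Lemma mxrank_equiv m n m' n' (a : 'M_(m, n)) (b : 'M_(m', n')) u v u' v' :
  b = u *m a *m v -> a = u' *m b *m v' -> r b = r a.
Proof. by move=> h h'; apply/eqP; rewrite eq_le !(mxrank_factor h, mxrank_factor h'). Qed.

(** The sum of two zero maps factors through one of them, so [r 0 + r 0 <= r 0]. *)
Lemma mxrank0 m n : r (0 : 'M_(m, n)) = 0.
Proof.
have h : r (0 : 'M_(m, n)) + r (0 : 'M_(m, n)) <= r (0 : 'M_(m, n)).
  rewrite -mxrank_diag block_mx0.
  by apply: (@mxrank_factor _ _ _ _ _ 0 0); rewrite !mulmx0.
by apply/eqP; rewrite eq_le mxrank_ge0 andbT -(lerD2l (r (0 : 'M_(m, n)))) addr0.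
Qed.

Lemma mxrankN m n (a : 'M_(m, n)) : r (- a) = r a.
Proof.
apply: (@mxrank_equiv _ _ _ _ _ _ (- 1%:M) 1%:M (- 1%:M) 1%:M);
by rewrite !mxunitE.
Qed.

Lemma mxrank_swap m n p q (a : 'M_(m, n)) (b : 'M_(p, q)) c d :
  r (block_mx a c d b) = r (block_mx b d c a).
Proof.
by apply: (@mxrank_equiv _ _ _ _ _ _ (block_mx 0 1%:M 1%:M 0) (block_mx 0 1%:M 1%:M 0)
   (block_mx 0 1%:M 1%:M 0) (block_mx 0 1%:M 1%:M 0)); rewrite !mxblockE !mxunitE.
Qed.

(* For [a = d_X^i], [b = d_Y^(i-1)], [c = f^i] over a field this is the rank of
   [H^i f]: the rank of the block matrix is
   [rank a + dim (c (ker a) + im b)]. *)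
Definition hrank m n p q (a : 'M_(m, n)) (c : 'M_(p, n)) (b : 'M_(p, q)) : R :=
  r (block_mx a 0 c b) - r a - r b.

Lemma hrank_ge0 m n p q (a : 'M_(m, n)) (c : 'M_(p, n)) (b : 'M_(p, q)) :
  0 <= hrank a c b.
Proof. by rewrite /hrank -addrA -opprD subr_ge0 mxrank_swap addrC mxrank_ut. Qed.

Lemma hrank_empty m n p q (a : 'M_(m, n)) (c : 'M_(p, n)) (b : 'M_(p, q)) :
  n = 0%N -> p = 0%N -> hrank a c b = 0.
Proof.
move=> n0 p0; subst n p; rewrite /hrank (thinmx0 a) (flatmx0 b) (flatmx0 c).
by rewrite block_mx0 !mxrank0 !subr0.
Qed.

Lemma hrank0 m n p q (c : 'M_(p, n)) : hrank (0 : 'M_(m, n)) c (0 : 'M_(p, q)) = r c.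
Proof.
rewrite /hrank !mxrank0 !subr0.
by apply: (@mxrank_equiv _ _ _ _ _ _ (col_mx 0 1%:M) (row_mx 1%:M 0)
  (row_mx 0 1%:M) (col_mx 1%:M 0)); rewrite !(mxblockE, mxunitE) // block_mxEh col_mx0.
Qed.

Lemma hrankNN m n p q (a : 'M_(m, n)) (c : 'M_(p, n)) (b : 'M_(p, q)) :
  hrank (- a) c (- b) = hrank a c b.
Proof.
rewrite /hrank !mxrankN; congr (_ - _ - _).
by apply: (@mxrank_equiv _ _ _ _ _ _ (block_mx (- 1%:M) 0 0 1%:M) (block_mx 1%:M 0 0 (- 1%:M))
  (block_mx (- 1%:M) 0 0 1%:M) (block_mx 1%:M 0 0 (- 1%:M))); rewrite !(mxblockE, mxunitE).
Qed.

(** A row operation with [a] and a column operation with [b] remove the terms [h' *m a] and [b *m h]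
    from the corner. *)
Lemma hrank_homotopy m n p q (a : 'M_(m, n)) (c c' : 'M_(p, n)) (b : 'M_(p, q)) h h' :
  c - c' = b *m h + h' *m a -> hrank a c b = hrank a c' b.
Proof.
move=> /eqP; rewrite subr_eq => /eqP ->; rewrite /hrank; congr (_ - _ - _).
apply: (@mxrank_equiv _ _ _ _ _ _ (block_mx 1%:M 0 h' 1%:M) (block_mx 1%:M 0 h 1%:M)
 (block_mx 1%:M 0 (- h') 1%:M) (block_mx 1%:M 0 (- h) 1%:M)).
  by rewrite !(mxblockE, mxunitE) -addrA addrC.
rewrite !(mxblockE, mxunitE); congr block_mx.
by rewrite [b *m h + _]addrC -[_ + _ + c']addrA addKr addrAC subrr add0r.
Qed.

(** Using [e] as a pivot clears [a] and [b] and leaves [- a *m b = 0], so only [e] survives. The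
    value is the dimension of the cohomology, over a field. *)
Lemma hrank_id m n p (e : 'M_n) (a : 'M_(m, n)) (b : 'M_(n, p)) :
  a *m e = a -> e *m b = b -> a *m b = 0 -> hrank a e b = r e - r a - r b.
Proof.
move=> ha hb hab; rewrite /hrank; congr (_ - _ - _).
rewrite -[RHS]add0r -(mxrank0 m p) -mxrank_diag.
apply: (@mxrank_equiv _ _ _ _ _ _ (block_mx 1%:M a 0 1%:M) (block_mx 0 1%:M 1%:M b)
 (block_mx 1%:M (- a) 0 1%:M) (block_mx (- b) 1%:M 1%:M 0));
by rewrite !(mxblockE, mxunitE) ?ha ?hb ?hab ?subrr ?addNr ?mxunitE.
Qed.

(** The permutation exchanging the two middle blocks; it regroups a block matrix of sums into a sum
    of block matrices. *)
Definition mxshuffle m n p q : 'M[A]_((m + n) + (p + q), (m + p) + (n + q)) :=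
  block_mx (block_mx 1%:M 0 0 0) (block_mx 0 0 1%:M 0)
    (block_mx 0 1%:M 0 0) (block_mx 0 0 0 1%:M).

Lemma hrank_sum m n p q m' n' p' q' (a : 'M_(m, n)) (c : 'M_(p, n)) (b : 'M_(p, q))
    (a' : 'M_(m', n')) (c' : 'M_(p', n')) (b' : 'M_(p', q')) :
  hrank (block_mx a 0 0 a') (block_mx c 0 0 c') (block_mx b 0 0 b') =
  hrank a c b + hrank a' c' b'.
Proof.
rewrite /hrank !mxrank_diag.
suff -> : r (block_mx (block_mx a 0 0 a') 0 (block_mx c 0 0 c') (block_mx b 0 0 b')) =
   r (block_mx a 0 c b) + r (block_mx a' 0 c' b').
  by lra.
rewrite -mxrank_diag.
apply: (@mxrank_equiv _ _ _ _ _ _ (mxshuffle _ _ _ _) (mxshuffle _ _ _ _)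
  (mxshuffle _ _ _ _) (mxshuffle _ _ _ _)); rewrite /mxshuffle;
by rewrite !(mxblockE, mxaddE, mxunitE).
Qed.

(** After the shuffle, [h] lies above the diagonal of a triangular matrix whose diagonal blocks are
    the two block matrices being compared. *)
Lemma hrank_ut m n p q m' n' p' q' (a : 'M_(m, n)) (c : 'M_(p, n)) (b : 'M_(p, q))
    (a' : 'M_(m', n')) (c' : 'M_(p', n')) (b' : 'M_(p', q')) h :
  hrank a c b + hrank a' c' b' <=
  hrank (block_mx a 0 0 a') (block_mx c h 0 c') (block_mx b 0 0 b').
Proof.
rewrite -hrank_sum /hrank !lerD2r.
set S := (X in X <= _); set T := (X in _ <= X).
have -> : S = r (block_mx a 0 c b) + r (block_mx a' 0 c' b').
  by have := hrank_sum a c b a' c' b'; rewrite /hrank !mxrank_diag -/S; lra.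
apply: le_trans (mxrank_ut _ _ (block_mx 0 0 h 0)) _.
apply: (@mxrank_factor _ _ _ _ _ (mxshuffle _ _ _ _) (mxshuffle _ _ _ _)).
by rewrite /mxshuffle !(mxblockE, mxaddE, mxunitE).
Qed.

(** Over a field, the map induced on cohomology by a composite factors through the first map. Here
    the subtracted terms [r b] and [r b'] differ, so the argument is that of Frobenius' inequality:
    a triangular matrix with diagonal blocks [b] and the matrix of [g *m c] is a two-sided multiple
    of the direct sum of the matrix of [c] and [b']. *)
Lemma hrank_compl m n p q p' q' (a : 'M_(m, n)) (c : 'M_(p, n)) (b : 'M_(p, q))
    (g : 'M_(p', p)) (b' : 'M_(p', q')) g' :
  g *m b = b' *m g' -> hrank a (g *m c) b' <= hrank a c b.
Proof.
move=> hg.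
suff: r b + r (block_mx a 0 (g *m c) b') <= r (block_mx a 0 c b) + r b'.
  by rewrite /hrank; lra.
rewrite -[X in _ <= X]mxrank_diag.
apply: le_trans (mxrank_ut _ _ (row_mx c 0)) _.
apply: (@mxrank_factor _ _ _ _ _
  (block_mx (row_mx 0 1%:M) 0 (block_mx 1%:M 0 0 g) (col_mx 0 1%:M))
  (block_mx (col_mx 0 1%:M) (block_mx 1%:M 0 0 0) (- g') (row_mx 0 1%:M))).
rewrite !(mxblockE, mxaddE, mxunitE).
by rewrite hg subrr col_mx0.
Qed.

(** Dual to [hrank_compl]: the differentials of the source change instead of those of the target. *)
Lemma hrank_compr m n p q m' n' (a : 'M_(m, n)) (c : 'M_(p, n)) (b : 'M_(p, q))
    (f : 'M_(n, n')) (a' : 'M_(m', n')) f' :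
  f' *m a' = a *m f -> hrank a' (c *m f) b <= hrank a c b.
Proof.
move=> hf.
suff: r (block_mx a' 0 (c *m f) b) + r a <= r (block_mx a 0 c b) + r a'.
  by rewrite /hrank; lra.
rewrite -[X in _ <= X]mxrank_diag.
apply: le_trans (mxrank_ut _ _ (col_mx 0 c)) _.
apply: (@mxrank_factor _ _ _ _ _
  (block_mx (block_mx 0 0 0 1%:M) (col_mx 1%:M 0) (row_mx 1%:M 0) (- f'))
  (block_mx (block_mx f 0 0 1%:M) (col_mx 1%:M 0) (row_mx 1%:M 0) 0)).
rewrite !(mxblockE, mxaddE, mxunitE).
rewrite hf subrr row_mx0; congr block_mx; rewrite block_mxEh.
have -> : col_mx (0 : 'M_(m', _)) (row_mx (c *m f) b) =
    row_mx (col_mx 0 (c *m f)) (col_mx 0 b) by rewrite -block_mxEh /block_mx row_mx0.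
by rewrite add_row_mx add_col_mx !mxunitE.
Qed.

(** The long exact cohomology sequence at the target of [c], in terms of ranks. In the matrix for
    the inclusion into the cone, the pivot [e] clears [b'], [c] and [b]; the leftover
    [- b' *m c = - c' *m a] is cleared by the row of [- a]. What remains is [e] and [a]. *)
Lemma hrank_cone m n p q m' (a : 'M_(m, n)) (c : 'M_(p, n)) (b : 'M_(p, q))
    (b' : 'M_(m', p)) (c' : 'M_(m', m)) (e : 'M_p) :
  b' *m c = c' *m a -> b' *m b = 0 -> e *m b = b -> e *m c = c -> b' *m e = b' ->
  hrank a c b + hrank b' (col_mx 0 e) (block_mx (- a) 0 c b) = hrank b' e b.
Proof.
move=> hc hb eb ec be; rewrite (hrank_id be eb hb).
suff E : r (block_mx b' 0 (col_mx 0 e) (block_mx (- a) 0 c b)) = r e + r a.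
  have F : r (block_mx (- a) 0 c b) = r (block_mx a 0 c b).
    apply: (@mxrank_equiv _ _ _ _ _ _ (block_mx (- 1%:M) 0 0 1%:M) 1%:M
      (block_mx (- 1%:M) 0 0 1%:M) 1%:M); by rewrite !(mxblockE, mxunitE).
  by rewrite /hrank E F; lra.
rewrite -mxrank_diag; apply: (@mxrank_equiv _ _ _ _ _ _
  (block_mx b' (- c') (col_mx 0 1%:M) (col_mx (- 1%:M) 0))
  (block_mx 1%:M (row_mx c b) 0 (row_mx 1%:M 0))
  (block_mx 0 (row_mx 0 1%:M) 0 (row_mx (- 1%:M) 0))
  (block_mx 1%:M (- c) 0 (col_mx 1%:M 0))).
  rewrite !(mxblockE, mxaddE, mxunitE) be ec eb hc hb.
  by rewrite subrr row_mx0 [block_mx (- a) _ _ _]block_mxEh.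
by rewrite !(mxblockE, mxaddE, mxunitE) ec addNr.
Qed.

End MatrixRank.

(** * Complexes and homotopies *)

Section Complexes.
Variable A : pzRingType.
Implicit Types X Y Z W : cplx A.

Lemma cplx_idem X : is_cplx X -> forall i, ce X i *m ce X i = ce X i.
Proof. by case=> _ []. Qed.

Lemma cplx_dd X : is_cplx X -> forall i, cd X (i + 1) *m cd X i = 0.
Proof. by case=> _ [_ []]. Qed.

Lemma sandwich_left m n (e : 'M[A]_m) (f : 'M[A]_(m, n)) e' :
  e *m e = e -> f = e *m f *m e' -> e *m f = f.
Proof. by move=> ee ->; rewrite !mulmxA ee. Qed.

Lemma sandwich_right m n e (f : 'M[A]_(m, n)) e' :
  e' *m e' = e' -> f = e *m f *m e' -> f *m e' = f.
Proof. by move=> ee ->; rewrite -!mulmxA ee. Qed.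

Lemma cplx_ed X : is_cplx X -> forall i, ce X (i + 1) *m cd X i = cd X i.
Proof. by case=> _ [ee [ed _]] i; apply: sandwich_left (ee _) (ed _). Qed.

Lemma cplx_de X : is_cplx X -> forall i, cd X i *m ce X i = cd X i.
Proof. by case=> _ [ee [ed _]] i; apply: sandwich_right (ee _) (ed _). Qed.

Lemma chain_d X Y (f : cmor X Y) : is_chain f ->
  forall i, f (i + 1) *m cd X i = cd Y i *m f i.
Proof. by case. Qed.

Lemma chain_el X Y (f : cmor X Y) : is_cplx Y -> is_chain f ->
  forall i, ce Y i *m f i = f i.
Proof. by case=> _ [ee _] [ef _] i; apply: sandwich_left (ee _) (ef _). Qed.

Lemma chain_er X Y (f : cmor X Y) : is_cplx X -> is_chain f ->
  forall i, f i *m ce X i = f i.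
Proof. by case=> _ [ee _] [ef _] i; apply: sandwich_right (ee _) (ef _). Qed.

Lemma chainI X Y (f : cmor X Y) :
  (forall i, ce Y i *m f i = f i) -> (forall i, f i *m ce X i = f i) ->
  (forall i, f (i + 1) *m cd X i = cd Y i *m f i) -> is_chain f.
Proof. by move=> l r c; split=> // i; rewrite l r. Qed.

Lemma cid_chain X : is_cplx X -> is_chain (cid X).
Proof.
move=> hX; apply: chainI => i; rewrite /cid ?(cplx_idem hX) //.
by rewrite (cplx_ed hX) (cplx_de hX).
Qed.

Lemma ccomp_chain X Y Z (f : cmor X Y) (g : cmor Y Z) :
  is_cplx X -> is_cplx Z -> is_chain f -> is_chain g -> is_chain (ccomp g f).
Proof.
move=> hX hZ hf hg; apply: chainI => i; rewrite /ccomp.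
- by rewrite mulmxA (chain_el hZ hg).
- by rewrite -mulmxA (chain_er hX hf).
- by rewrite -mulmxA (chain_d hf) !mulmxA (chain_d hg).
Qed.

Lemma shift_cplx X : is_cplx X -> is_cplx (shift X).
Proof.
move=> hX; split; [case: (hX) => [[N hN] _]; exists N.+1 => i hi /=|split; [|split]] => /=.
- apply: hN; move: hi; case: i => [] i; rewrite ?NegzE; lia.
- by move=> i; apply: cplx_idem.
- by move=> i; rewrite mulmxN mulNmx (cplx_ed hX) (cplx_de hX).
- by move=> i; rewrite mulmxN mulNmx opprK (cplx_dd hX).
Qed.

Lemma shiftm_chain X Y (f : cmor X Y) : is_chain f -> is_chain (shiftm f).
Proof. by case=> hf cf; split=> i; rewrite /shiftm //= mulmxN mulNmx cf. Qed.

Lemma cone_cplx X Y (f : cmor X Y) :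
  is_cplx X -> is_cplx Y -> is_chain f -> is_cplx (cone f).
Proof.
move=> hX hY hf; split; [|split; [|split]].
- case: hX hY => [[N hN] _] [[M hM] _]; exists (N + M).+1 => i hi /=.
  by rewrite hN ?hM //; move: hi; case: i => [] i; rewrite ?NegzE; lia.
- by move=> i; rewrite /= !(mxblockE, mxunitE) !cplx_idem.
- move=> i; rewrite /= !(mxblockE, mxunitE) !cplx_ed // !cplx_de //.
  by rewrite (chain_el hY hf) (chain_er hX hf).
- move=> i; rewrite /= !(mxblockE, mxunitE) !cplx_dd //.
  by rewrite (chain_d hf) addNr !mxunitE.
Qed.

Lemma cone_in_chain X Y (f : cmor X Y) : is_cplx Y -> is_chain (cone_in f).
Proof.
move=> hY; apply: chainI => i; rewrite /cone_in /= !(mxblockE, mxunitE) ?cplx_idem //.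
by rewrite cplx_ed // cplx_de.
Qed.

Lemma cone_out_chain X Y (f : cmor X Y) : is_cplx X -> is_chain (cone_out f).
Proof.
move=> hX; apply: chainI => i; rewrite /cone_out /= !(mxblockE, mxunitE) ?cplx_idem //.
by rewrite cplx_ed // cplx_de.
Qed.

Lemma eq_homotopic X Y (f g : cmor X Y) : (forall i, f i = g i) -> homotopic f g.
Proof.
by move=> fg; exists (fun=> 0); split=> i; rewrite ?fg !mxunitE ?subrr.
Qed.

Lemma homotopic_compr X Y Z (u : cmor X Y) (f g : cmor Y Z) : is_cplx X -> is_cplx Z ->
  is_chain u -> homotopic f g -> homotopic (ccomp f u) (ccomp g u).
Proof.
move=> hX hZ hu [h [eh hh]]; exists (fun i => h i *m u (i + 1)); split=> i.
  rewrite -!mulmxA (chain_er hX hu) [in RHS]mulmxA.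
  by rewrite (sandwich_left (cplx_idem hZ i) (eh i)).
by rewrite /ccomp -mulmxBl hh mulmxDl -!mulmxA (chain_d hu).
Qed.

Lemma homotopic_compl X Y Z (u : cmor Y Z) (f g : cmor X Y) : is_cplx X -> is_cplx Z ->
  is_chain u -> homotopic f g -> homotopic (ccomp u f) (ccomp u g).
Proof.
move=> hX hZ hu [h [eh hh]]; exists (fun i => u i *m h i); split=> i.
  rewrite !mulmxA (chain_el hZ hu) -[in RHS]mulmxA.
  by rewrite (sandwich_right (cplx_idem hX (i + 1)) (eh i)).
by rewrite /ccomp -mulmxBr hh mulmxDr !mulmxA (chain_d hu).
Qed.

End Complexes.

(** * From matrix ranks to rank functions on complexes *)

Section Existence.
Variables (R : realType) (A : pzRingType).
Variable r : forall m n, 'M[A]_(m, n) -> R.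
Hypothesis rP : is_mxrank r.
Implicit Types X Y Z W : cplx A.

(** Indexing by [i + 1] lets the incoming differential be [cd Y i], with no transport along
    [i - 1 + 1 = i]. *)
Definition cohrank X Y (f : cmor X Y) (i : int) : R :=
  hrank r (cd X (i + 1)) (f (i + 1)) (cd Y i).

(* The coefficient of [q^k] comes from cohomological degree [-k], since the
   shift lowers degrees; [cohrank f i] lives in degree [i + 1]. *)
Definition mx_rankfun : rankfun R A := fun X Y f k => cohrank f (- k - 1).

Lemma cohrank_homotopic X Y (f g : cmor X Y) : homotopic f g -> cohrank f =1 cohrank g.
Proof. by case=> h [_ hh] i; apply: (hrank_homotopy rP); apply: hh. Qed.

Lemma cohrank_compl X Y Z (f : cmor X Y) (g : cmor Y Z) i :
  is_chain g -> cohrank (ccomp g f) i <= cohrank f i.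
Proof. by move=> hg; apply: (hrank_compl rP); apply: chain_d. Qed.

Lemma cohrank_compr X Y Z (f : cmor X Y) (g : cmor Y Z) i :
  is_chain f -> cohrank (ccomp g f) i <= cohrank g i.
Proof. by move=> hf; apply: (hrank_compr rP); apply: chain_d. Qed.

Lemma cohrank_isol X Y Z (f : cmor X Y) (b : cmor Y Z) : is_cplx X -> is_cplx Y ->
  is_chain f -> is_iso b -> cohrank (ccomp b f) =1 cohrank f.
Proof.
move=> hX hY hf [hb [b' [hb' [bb _]]]] i; apply/eqP; rewrite eq_le cohrank_compl //=.
have e : homotopic (ccomp b' (ccomp b f)) f.
  have [h [eh hh]] := homotopic_compr hX hY hf bb; exists h; split=> // j.
  by rewrite -hh /ccomp /cid mulmxA (chain_el hY hf).
by rewrite -(cohrank_homotopic e) cohrank_compl.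
Qed.

Lemma cohrank_isor X Y Z (a : cmor X Y) (f : cmor Y Z) : is_cplx Y -> is_cplx Z ->
  is_chain f -> is_iso a -> cohrank (ccomp f a) =1 cohrank f.
Proof.
move=> hY hZ hf [ha [a' [ha' [_ aa]]]] i; apply/eqP; rewrite eq_le cohrank_compr //=.
have e : homotopic (ccomp (ccomp f a) a') f.
  have [h [eh hh]] := homotopic_compl hY hZ hf aa; exists h; split=> // j.
  by rewrite -hh /ccomp /cid mulmxA (chain_er hY hf).
by rewrite -(cohrank_homotopic e) cohrank_compr.
Qed.

Lemma cohrank_cone X Y (f : cmor X Y) i : is_cplx X -> is_cplx Y -> is_chain f ->
  cohrank f i + cohrank (cone_in f) i = cohrank (cid Y) i.
Proof.
move=> hX hY hf; apply: (hrank_cone rP (c' := f (i + 1 + 1))).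
- by rewrite (chain_d hf).
- exact: cplx_dd.
- exact: cplx_ed.
- exact: chain_el.
- exact: cplx_de.
Qed.

Lemma cohrank_exact X Y Z (u : cmor X Y) (v : cmor Y Z) (w : cmor Z (shift X)) i :
  is_cplx X -> is_cplx Y -> is_cplx Z -> exact_tri u v w ->
  cohrank u i + cohrank v i = cohrank (cid Y) i.
Proof.
move=> hX hY hZ [hu [hv [_ [X' [Y' [f [a [b [c]]]]]]]]].
move=> [hX' [hY' [hf [ia [ib [ic [bu [cv _]]]]]]]].
have hC := cone_cplx hX' hY' hf.
(* The isomorphism with a standard triangle moves both ranks to [f] and [cone_in f]. *)
rewrite -(cohrank_isol hX hY hu ib) (cohrank_homotopic bu) (cohrank_isor hX' hY' hf ia).
rewrite -(cohrank_isol hY hZ hv ic) (cohrank_homotopic cv).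
rewrite (cohrank_isor hY' hC (cone_in_chain _ hY') ib) cohrank_cone //.
have hb : is_chain b by case: ib.
(* The isomorphism [b] intertwines the identities of [Y] and [Y'], so these have equal rank. *)
rewrite -(cohrank_isor hY' hY' (cid_chain hY') ib).
rewrite -(cohrank_isol hY hY (cid_chain hY) ib).
apply: cohrank_homotopic; apply: eq_homotopic => j.
by rewrite /ccomp /cid (chain_el hY' hb) (chain_er hY hb).
Qed.

Lemma cohrank_id X i : is_cplx X ->
  cohrank (cid X) i = r (ce X (i + 1)) - r (cd X (i + 1)) - r (cd X i).
Proof.
move=> hX; apply: (hrank_id rP).
- exact: cplx_de.
- exact: cplx_ed.
- exact: cplx_dd.
Qed.

Lemma mx_rankfunP : is_rankfun Infty mx_rankfun.
Proof.
split; [|split; [|split; [|split; [|split; [|split]]]]].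
- move=> X Y f hX hY hf; split; last by move=> k; apply: (hrank_ge0 rP).
  case: hX hY => [[N hN] _] [[M hM] _]; exists (N + M).+1 => k hk.
  have kX : cn X (- k - 1 + 1) = 0%N by apply: hN; lia.
  have kY : cn Y (- k - 1 + 1) = 0%N by apply: hM; lia.
  exact: (hrank_empty rP).
- by move=> X Y f g _ _ _ _ fg k; apply: cohrank_homotopic.
- move=> X Y f _ _ _ k; rewrite /qmul /mx_rankfun.
  (* Multiplication by [q] matches the move by one cohomological degree; the sign that the shift
     puts on the differentials is harmless by [hrankNN]. *)
  have -> : - (k - 1) - 1 = - k - 1 + 1 :> int by lia.
  exact: (hrankNN rP).
- by move=> X Y Z W f g _ _ _ _ _ _ k; apply: (hrank_sum rP).
- by move=> X Y Z u v w hX hY hZ t k; apply: cohrank_exact t.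
- by move=> X Y Z W f h g _ _ _ _ _ _ _ k; apply: (hrank_ut rP).
- by move=> X Y Z f g _ _ _ hf hg; split=> k; [apply: cohrank_compl|apply: cohrank_compr].
Qed.

Lemma mx_rankfun_deg0 (P Q : pobj A) (f : pmor P Q) (k : int) :
  mx_rankfun (deg0m f) k = if k == 0 then r f else 0.
Proof.
rewrite /mx_rankfun /cohrank (hrank0 rP) -oppr_eq0.
have -> : (- k == 0) = (- k - 1 + 1 == 0) by rewrite subrK.
by rewrite /deg0m /=; case: (_ == 0); rewrite ?(mxrank0 rP).
Qed.

End Existence.

(** * Rank functions and triangles *)

Section RankFunction.
Variables (R : realType) (A : pzRingType) (d : period) (rho : rankfun R A).
Hypothesis rhoP : is_rankfun d rho.
Arguments rho {X Y} _ _.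
Implicit Types X Y Z W : cplx A.

Local Ltac chains :=
  eauto 10 using cid_chain, ccomp_chain, shift_cplx, shiftm_chain, cone_cplx,
    cone_in_chain, cone_out_chain.

Lemma rk_ge0 X Y (f : cmor X Y) k :
  is_cplx X -> is_cplx Y -> is_chain f -> 0 <= rho f k.
Proof. by case: rhoP => r0 _ hX hY hf; case: (r0 _ _ _ hX hY hf). Qed.

Lemma rk_homotopic X Y (f g : cmor X Y) : is_cplx X -> is_cplx Y ->
  is_chain f -> is_chain g -> homotopic f g -> rho f =1 rho g.
Proof. by case: rhoP => _ [h _]; apply: h. Qed.

Lemma rk_shift X Y (f : cmor X Y) k : is_cplx X -> is_cplx Y -> is_chain f ->
  rho (shiftm f) k = rho f (k - 1).
Proof. by case: rhoP => _ [_ [h _]] *; apply: h. Qed.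

Lemma rk_sum X Y Z W (f : cmor X Y) (g : cmor Z W) k :
  is_cplx X -> is_cplx Y -> is_cplx Z -> is_cplx W -> is_chain f -> is_chain g ->
  rho (csumm f g) k = rho f k + rho g k.
Proof. by case: rhoP => _ [_ [_ [h _]]] *; apply: h. Qed.

Lemma rk_ut X Y Z W (f : cmor X Y) (h : cmor Z Y) (g : cmor Z W) k :
  is_cplx X -> is_cplx Y -> is_cplx Z -> is_cplx W ->
  is_chain f -> is_chain h -> is_chain g ->
  rho f k + rho g k <= rho (ctri f h g) k.
Proof. by case: rhoP => _ [_ [_ [_ [_ [r _]]]]] *; apply: r. Qed.

Lemma rk_compl X Y Z (f : cmor X Y) (g : cmor Y Z) k :
  is_cplx X -> is_cplx Y -> is_cplx Z -> is_chain f -> is_chain g ->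
  rho (ccomp g f) k <= rho f k.
Proof.
by case: rhoP => _ [_ [_ [_ [_ [_ h]]]]] hX hY hZ hf hg; case: (h _ _ _ _ _ hX hY hZ hf hg).
Qed.

Lemma rk_compr X Y Z (f : cmor X Y) (g : cmor Y Z) k :
  is_cplx X -> is_cplx Y -> is_cplx Z -> is_chain f -> is_chain g ->
  rho (ccomp g f) k <= rho g k.
Proof.
by case: rhoP => _ [_ [_ [_ [_ [_ h]]]]] hX hY hZ hf hg; case: (h _ _ _ _ _ hX hY hZ hf hg).
Qed.

(** Morphisms are families of matrices, so the factorization is asked degree by degree and enters as
    a zero homotopy, in place of functional extensionality. *)
Lemma rk_factor X Y X' Y' (f : cmor X Y) (f' : cmor X' Y') (a : cmor X' X)
    (b : cmor Y Y') k :
  is_cplx X -> is_cplx Y -> is_cplx X' -> is_cplx Y' ->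
  is_chain f -> is_chain a -> is_chain b ->
  (forall i, f' i = b i *m f i *m a i) -> rho f' k <= rho f k.
Proof.
move=> hX hY hX' hY' hf ha hb e.
have hg : is_chain (ccomp b (ccomp f a)) by chains.
have ef i : f' i = ccomp b (ccomp f a) i by rewrite e /ccomp mulmxA.
have hf' : is_chain f' by case: hg => eg cg; split=> i; rewrite !ef; [apply: eg|apply: cg].
rewrite (rk_homotopic hX' hY' hf' hg (eq_homotopic ef)).
by apply: (le_trans (rk_compl k _ _ _ _ _)) => //; [chains..|apply: rk_compr].
Qed.

Lemma rk_equiv X Y X' Y' (f : cmor X Y) (f' : cmor X' Y')
    (a : cmor X' X) (b : cmor Y Y') (a' : cmor X X') (b' : cmor Y' Y) k :
  is_cplx X -> is_cplx Y -> is_cplx X' -> is_cplx Y' ->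
  is_chain f -> is_chain f' -> is_chain a -> is_chain b -> is_chain a' -> is_chain b' ->
  (forall i, f' i = b i *m f i *m a i) -> (forall i, f i = b' i *m f' i *m a' i) ->
  rho f' k = rho f k.
Proof.
move=> hX hY hX' hY' hf hf' ha hb ha' hb' e e'; apply/eqP; rewrite eq_le.
by rewrite (rk_factor k _ _ _ _ _ _ _ e) // (rk_factor k _ _ _ _ _ _ _ e').
Qed.

Lemma rk_le_dom X Y (f : cmor X Y) k : is_cplx X -> is_cplx Y -> is_chain f ->
  rho f k <= rho (cid X) k.
Proof.
move=> hX hY hf; apply: (rk_factor (a := cid X) (b := f)) => //; [chains..|move=> i].
by rewrite /cid !(chain_er hX hf).
Qed.

Lemma rk_le_cod X Y (f : cmor X Y) k : is_cplx X -> is_cplx Y -> is_chain f ->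
  rho f k <= rho (cid Y) k.
Proof.
move=> hX hY hf; apply: (rk_factor (a := f) (b := cid Y)) => //; [chains..|move=> i].
by rewrite /cid -mulmxA !(chain_el hY hf).
Qed.

Lemma cid_iso X : is_cplx X -> is_iso (cid X).
Proof.
move=> hX; split; first exact: cid_chain.
by exists (cid X); split; [chains|split; apply: eq_homotopic => i; apply: cplx_idem].
Qed.

Lemma cone_exact X Y (f : cmor X Y) : is_cplx X -> is_cplx Y -> is_chain f ->
  exact_tri f (cone_in f) (cone_out f).
Proof.
move=> hX hY hf; split=> //; split; [chains|split; [chains|]].
exists X, Y, f, (cid X), (cid Y), (cid (cone f)).
do 3!split=> //; split; [|split; [|split; [|split; [|split]]]].
- exact: cid_iso.
- exact: cid_iso.
- by apply: cid_iso; chains.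
- by apply: eq_homotopic => i; rewrite /ccomp /cid (chain_el hY hf) (chain_er hX hf).
- apply: eq_homotopic => i; have hc := cone_in_chain f hY.
  by rewrite /ccomp /cid (chain_el (cone_cplx hX hY hf) hc) (chain_er hY hc).
- apply: eq_homotopic => i; have hc := cone_out_chain f hX.
  rewrite /ccomp [RHS](chain_er (cone_cplx hX hY hf) hc).
  exact: (chain_el (shift_cplx hX) hc).
Qed.

Lemma rk_cone_in X Y (f : cmor X Y) k : is_cplx X -> is_cplx Y -> is_chain f ->
  rho f k + rho (cone_in f) k = rho (cid Y) k.
Proof.
move=> hX hY hf; case: rhoP => _ [_ [_ [_ [h _]]]].
by apply: (h _ _ (cone f)); [..|exact: cone_exact]; chains.
Qed.

Lemma rk_opp X Y (f : cmor X Y) k : is_cplx X -> is_cplx Y -> is_chain f ->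
  rho (fun i => - f i) k = rho f k.
Proof.
move=> hX hY hf.
have hn (Z : cplx A) : is_cplx Z -> is_chain (fun i => - cid Z i).
  move=> hZ; apply: chainI => i; rewrite /cid !mxunitE ?cplx_idem //.
  by rewrite cplx_ed // cplx_de.
have hnf : is_chain (fun i => - f i).
  by apply: chainI => i; rewrite !mxunitE ?(chain_el hY hf) ?(chain_er hX hf) ?(chain_d hf).
apply: (rk_equiv (a := cid X) (a' := cid X) (b := fun i => - cid Y i)
  (b' := fun i => - cid Y i)) => //; try exact: hn; try exact: cid_chain.
- by move=> i; rewrite /cid !mxunitE (chain_el hY hf) (chain_er hX hf).
- by move=> i; rewrite /cid !mxunitE (chain_el hY hf) (chain_er hX hf).
Qed.

(** * Rotation of triangles *)

Section Rotation.
Variables (X Y : cplx A) (f : cmor X Y).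
Hypotheses (hX : is_cplx X) (hY : is_cplx Y) (hf : is_chain f).

(* Homotopy inverse equivalences between [shift X] and the cone of [Y -> cone f],
   which rotate the triangle of [f]. *)
Definition rot_in : cmor (shift X) (cone (cone_in f)) :=
  fun i => col_mx (- f (i + 1)) (col_mx (ce X (i + 1)) 0).
Definition rot_out : cmor (cone (cone_in f)) (shift X) :=
  fun i => row_mx 0 (row_mx (ce X (i + 1)) 0).

Let hC : is_cplx (cone f) := cone_cplx hX hY hf.
Let hi : is_chain (cone_in f) := cone_in_chain f hY.
Let hD : is_cplx (cone (cone_in f)) := cone_cplx hY hC hi.

Lemma rot_in_chain : is_chain rot_in.
Proof.
apply: chainI => i; rewrite /rot_in /= !(mxblockE, mxunitE) ?cplx_idem
  ?(chain_el hY hf) ?(chain_er hX hf) //.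
by rewrite cplx_ed // cplx_de // !(chain_d hf) add_col_mx add0r addNr.
Qed.

Lemma rot_out_chain : is_chain rot_out.
Proof.
apply: chainI => i; rewrite /rot_out /= !(mxblockE, mxunitE) ?cplx_idem //.
by rewrite cplx_ed // cplx_de.
Qed.

(** The triangle axiom sees only the first two maps of a triangle. Identifying the iterated
    [cone_in] with the next map of the original triangle makes it available for the rotated
    triangles. *)
Lemma rk_cone_in_cone_in k : rho (cone_in (cone_in f)) k = rho (cone_out f) k.
Proof.
have ho := cone_out_chain f hX; have hi2 := cone_in_chain (cone_in f) hC.
have hr := rot_in_chain; have hs := rot_out_chain.
have e : homotopic (cone_in (cone_in f)) (ccomp rot_in (cone_out f)).
  (* The cone of [cone_in f] contains two copies of [Y] joined by the identity; the homotopy maps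
     one to the other. *)
  exists (fun i => block_mx 0 (ce Y (i + 1)) 0 0); split=> i.
    by rewrite /= !(mxblockE, mxunitE) !cplx_idem.
  rewrite /ccomp /cone_in /rot_in /cone_out /=.
  rewrite !(mxblockE, add_block_mx, opp_block_mx, mxunitE) ?cplx_idem //.
  rewrite col_mx0_block !mxaddE !mxunitE (chain_el hY hf) (chain_er hX hf).
  by rewrite cplx_de // cplx_ed // addNr subrr mxunitE.
apply/eqP; rewrite eq_le; apply/andP; split.
  by rewrite (rk_homotopic _ _ _ _ e) //; [apply: rk_compl|..]; chains.
apply: (rk_factor (f := cone_in (cone_in f)) (b := rot_out) (a := cid _)) => //; [chains..|].
move=> i; rewrite /rot_out /cone_in /cone_out /cid /=.
by rewrite !(mxblockE, mxaddE, mxunitE) !cplx_idem.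
Qed.

(** Rotation produces [- shiftm f], whose sign [rk_opp] removes. *)
Lemma rk_cone_out_cone_in k : rho (cone_out (cone_in f)) k = rho (shiftm f) k.
Proof.
have ho := cone_out_chain (cone_in f) hY.
have hr := rot_in_chain; have hs := rot_out_chain; have hsf := shiftm_chain hf.
have hn : is_chain (fun i => - shiftm f i).
  apply: chainI => i; rewrite !mxunitE /shiftm /= ?(chain_el hY hf) ?(chain_er hX hf) //.
  by rewrite ?mxunitE (chain_d hf).
have e : homotopic (cone_out (cone_in f)) (ccomp (fun i => - shiftm f i) rot_out).
  exists (fun i => row_mx 0 (row_mx 0 (ce Y (i + 1)))); split=> i.
    by rewrite /= !(mxblockE, mxunitE) !cplx_idem.
  rewrite /ccomp /cone_out /rot_out /shiftm /=.
  rewrite !(mxblockE, mxaddE, mxunitE) ?cplx_idem //.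
  rewrite (chain_el hY hf) (chain_er hX hf).
  by rewrite cplx_de // cplx_ed // addNr.
rewrite -(rk_opp k _ _ hsf); [|chains..].
apply/eqP; rewrite eq_le; apply/andP; split.
  by rewrite (rk_homotopic _ _ _ _ e) //; [apply: rk_compr|..]; chains.
apply: (rk_factor (f := cone_out (cone_in f)) (a := rot_in) (b := cid _)) => //; [chains..|].
move=> i; rewrite /rot_in /shiftm /cone_out /cid /=.
by rewrite !(mxblockE, mxaddE, mxunitE) !cplx_idem ?(chain_el hY hf).
Qed.

Lemma rk_cone_cone_in k : rho (cid (cone (cone_in f))) k = rho (cid (shift X)) k.
Proof.
have hr := rot_in_chain; have hs := rot_out_chain; have hsX := shift_cplx hX.
have e : homotopic (cid (cone (cone_in f))) (ccomp rot_in rot_out).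
  exists (fun i => block_mx 0 (row_mx 0 (ce Y (i + 1))) 0 0); split=> i.
    by rewrite /= !(mxblockE, mxunitE) !cplx_idem.
  rewrite /ccomp /cid /rot_in /rot_out /=.
  rewrite !(mxblockE, mxaddE, mxunitE) ?cplx_idem //.
  rewrite (chain_el hY hf) (chain_er hX hf).
  by rewrite cplx_de // cplx_ed // addNr subrr row_mx0.
apply/eqP; rewrite eq_le; apply/andP; split.
  rewrite (rk_homotopic _ _ _ _ e) //; [|chains..].
  apply: (rk_factor (f := cid (shift X)) (a := rot_out) (b := rot_in)) => //; [chains..|].
  by move=> i; rewrite /cid (chain_er hsX hr).
apply: (rk_factor (f := cid (cone (cone_in f))) (a := rot_in) (b := rot_out)) => //; [chains..|].
move=> i; rewrite /cid (chain_er hD hs) /rot_in /rot_out /=.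
by rewrite !(mxblockE, mxaddE, mxunitE) !cplx_idem.
Qed.

End Rotation.

Lemma rk_cone X Y (f : cmor X Y) k : is_cplx X -> is_cplx Y -> is_chain f ->
  rho (cone_in f) k + rho (cone_out f) k = rho (cid (cone f)) k.
Proof.
move=> hX hY hf; rewrite -rk_cone_in_cone_in //.
by apply: rk_cone_in; chains.
Qed.

(** The triangle axiom for [cone_in (cone_in f)], transported along the three rotation
    equalities. *)
Lemma rk_cone_out X Y (f : cmor X Y) k : is_cplx X -> is_cplx Y -> is_chain f ->
  rho (cone_out f) k + rho f (k - 1) = rho (cid X) (k - 1).
Proof.
move=> hX hY hf; have hc := cone_in_chain f hY; have hC := cone_cplx hX hY hf.
have hsX := shift_cplx hX; have hi := cid_chain hX.
rewrite -[RHS]rk_shift //.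
have -> : rho (shiftm (cid X)) k = rho (cid (shift X)) k by [].
rewrite -rk_shift // -(rk_cone_out_cone_in hX hY hf) -rk_cone_in_cone_in //.
rewrite -(rk_cone_cone_in hX hY hf) -rk_cone_in_cone_in //.
by apply: rk_cone_in; chains.
Qed.

(** * Direct sums and Frobenius' inequality *)

Lemma csum_cplx X Y : is_cplx X -> is_cplx Y -> is_cplx (csum X Y).
Proof.
move=> hX hY; split; [|split; [|split]] => [|i|i|i].
- case: hX hY => [[N hN] _] [[M hM] _]; exists (N + M)%N => i hi /=.
  by rewrite hN ?hM //; lia.
- by rewrite /= !(mxblockE, mxunitE) !cplx_idem.
- by rewrite /= !(mxblockE, mxunitE) !cplx_ed // !cplx_de.
- by rewrite /= !(mxblockE, mxunitE) !cplx_dd // block_mx0.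
Qed.

Lemma csumm_chain X Y Z W (f : cmor X Y) (g : cmor Z W) :
  is_chain f -> is_chain g -> is_chain (csumm f g).
Proof.
move=> [ef cf] [eg cg]; split=> i; rewrite /csumm /= !(mxblockE, mxunitE).
  by rewrite -ef -eg.
by rewrite cf cg.
Qed.

Lemma ctri_chain X Y Z W (f : cmor X Y) (h : cmor Z Y) (g : cmor Z W) :
  is_chain f -> is_chain h -> is_chain g -> is_chain (ctri f h g).
Proof.
move=> [ef cf] [eh ch] [eg cg]; split=> i; rewrite /ctri /= !(mxblockE, mxunitE).
  by rewrite -ef -eh -eg.
by rewrite cf ch cg.
Qed.

(** The triangular morphism with diagonal [f], [g] and corner the identity of [Y] has rank at least
    [rho f + rho g]. Elimination with the identity as pivot writes it as a two-sided multiple of the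
    direct sum of [ccomp g f] and [cid Y]. *)
Lemma rk_frobenius X Y Z (f : cmor X Y) (g : cmor Y Z) k :
  is_cplx X -> is_cplx Y -> is_cplx Z -> is_chain f -> is_chain g ->
  rho f k + rho g k <= rho (ccomp g f) k + rho (cid Y) k.
Proof.
move=> hX hY hZ hf hg.
have hi := cid_chain hY; have hgf := ccomp_chain hX hZ hf hg.
apply: le_trans (rk_ut k hX hY hY hZ hf hi hg) _.
rewrite -rk_sum //.
pose a : cmor (csum X Y) (csum X Y) := fun i => block_mx (- ce X i) 0 (f i) (ce Y i).
pose b : cmor (csum Z Y) (csum Y Z) := fun i => block_mx 0 (ce Y i) (ce Z i) (g i).
have el := chain_el hY hf; have er := chain_er hX hf.
have gl := chain_el hZ hg; have gr := chain_er hY hg.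
apply: (rk_factor (f := csumm (ccomp g f) (cid Y)) (a := a) (b := b)).
- exact: csum_cplx.
- exact: csum_cplx.
- exact: csum_cplx.
- exact: csum_cplx.
- exact: csumm_chain.
- apply: chainI => i; rewrite /a /= !(mxblockE, mxaddE, mxunitE) ?cplx_idem ?el ?er //.
  by rewrite ?cplx_ed // ?cplx_de // (chain_d hf).
- apply: chainI => i; rewrite /b /= !(mxblockE, mxaddE, mxunitE) ?cplx_idem ?gl ?gr //.
  by rewrite ?cplx_ed // ?cplx_de // (chain_d hg).
- move=> i; rewrite /a /b /csumm /ctri /ccomp /cid /= !(mxblockE, mxaddE, mxunitE).
  by rewrite !cplx_idem // el !gr !mulmxA gl -[g i *m f i *m ce X i]mulmxA er addNr.
Qed.

Lemma rk_zero X k : is_cplx X -> (forall i, ce X i = 0) -> rho (cid X) k = 0.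
Proof.
move=> hX e0; have hi := cid_chain hX; have hXX := csum_cplx hX hX.
apply/eqP; rewrite eq_le rk_ge0 // andbT.
rewrite -(lerD2l (rho (cid X) k)) addr0 -rk_sum //.
apply: (rk_factor (a := (fun=> 0) : cmor (csum X X) X)
  (b := (fun=> 0) : cmor X (csum X X))) => //.
- by split=> i; rewrite !mxunitE.
- by split=> i; rewrite !mxunitE.
- by move=> i; rewrite /csumm /cid e0 !mxunitE.
Qed.

End RankFunction.

(** * Restriction to degree zero *)

Section DegreeZero.
Variables (R : realType) (A : pzRingType) (d : period) (rho : rankfun R A).
Hypotheses (hd : valid_period d) (rhoP : is_rankfun d rho) (rho1 : normalized d rho).
Arguments rho {X Y} _ _.
Implicit Types P Q S T : pobj A.

Lemma deg0_cplx P : is_pobj P -> is_cplx (deg0 P).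
Proof.
move=> hP; split; [|split; [|split]] => [|i|i|i] /=; rewrite ?mxunitE //.
  by exists 0%N => i; case: eqP => // ->.
by case: (i == 0); rewrite ?mxunitE.
Qed.

Lemma deg0m_comp P Q S (f : pmor P Q) (g : pmor Q S) i :
  deg0m (g *m f : pmor P S) i = deg0m g i *m deg0m f i.
Proof. by rewrite /deg0m /=; case: (i == 0); rewrite ?mxunitE. Qed.

Lemma deg0m_chain P Q (f : pmor P Q) : is_pmor f -> is_chain (deg0m f).
Proof.
move=> hf; split=> i; rewrite /= ?mxunitE // /deg0m /=.
by case: (i == 0); rewrite ?mxunitE // -hf.
Qed.

Lemma rk_deg0_comp P Q S (f : pmor P Q) (g : pmor Q S) k :
  is_pobj P -> is_pobj Q -> is_pobj S -> is_pmor f -> is_pmor g ->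
  rho (deg0m (Defs.pcomp g f)) k <= rho (deg0m f) k /\
  rho (deg0m (Defs.pcomp g f)) k <= rho (deg0m g) k.
Proof.
move=> hP hQ hS hf hg; have [[cP cQ] cS] := (deg0_cplx hP, deg0_cplx hQ, deg0_cplx hS).
have iP : is_pmor (pid P) by rewrite /is_pmor /pid !hP.
have iS : is_pmor (pid S) by rewrite /is_pmor /pid !hS.
have rf : f *m pe P = f := sandwich_right hP hf.
have lg : pe S *m g = g := sandwich_left hS hg.
split.
  apply: (rk_factor rhoP (a := deg0m (pid P)) (b := deg0m g)) => //; try exact: deg0m_chain.
  by move=> i; rewrite -!deg0m_comp /pid -mulmxA rf.
apply: (rk_factor rhoP (a := deg0m f) (b := deg0m (pid S))) => //; try exact: deg0m_chain.
by move=> i; rewrite -!deg0m_comp /pid lg.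
Qed.

Section DirectSum.
Variables P Q : pobj A.

(** The two complexes have the same terms, but their sizes become convertible only after a case
    analysis on [i == 0]; hence comparison maps instead of an equality. *)
Definition psum_to_csum : cmor (deg0 (psum P Q)) (csum (deg0 P) (deg0 Q)) :=
  fun i => if i == 0 as b return
     'M_((if b then pn P else 0) + (if b then pn Q else 0), if b then pn P + pn Q else 0)
   then pe (psum P Q) else 0.

Definition csum_to_psum : cmor (csum (deg0 P) (deg0 Q)) (deg0 (psum P Q)) :=
  fun i => if i == 0 as b return
     'M_(if b then pn P + pn Q else 0, (if b then pn P else 0) + (if b then pn Q else 0))
   then pe (psum P Q) else 0.

Hypotheses (hP : is_pobj P) (hQ : is_pobj Q).

Lemma psum_pobj : is_pobj (psum P Q).
Proof. by rewrite /is_pobj /= !(mxblockE, mxunitE) hP hQ. Qed.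

Lemma psum_to_csum_chain : is_chain psum_to_csum.
Proof.
split=> i; rewrite /= ?mxunitE // /psum_to_csum.
by case: (i == 0); rewrite /= ?mxunitE // !(mxblockE, mxunitE) !(hP, hQ).
Qed.

Lemma csum_to_psum_chain : is_chain csum_to_psum.
Proof.
split=> i; rewrite /= ?mxunitE // /csum_to_psum.
by case: (i == 0); rewrite /= ?mxunitE // !(mxblockE, mxunitE) !(hP, hQ).
Qed.

End DirectSum.

Lemma deg0m_ctri P Q S T (f : pmor P Q) (h : pmor S Q) (g : pmor S T) i :
  is_pobj P -> is_pobj Q -> is_pobj S -> is_pobj T ->
  is_pmor f -> is_pmor h -> is_pmor g ->
  deg0m (ptri f h g) i = csum_to_psum Q T i *m ctri (deg0m f) (deg0m h) (deg0m g) i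
     *m psum_to_csum P S i
  /\ ctri (deg0m f) (deg0m h) (deg0m g) i =
     psum_to_csum Q T i *m deg0m (ptri f h g) i *m csum_to_psum P S i.
Proof.
move=> hP hQ hS hT hf hh hg.
have [[lf lh] lg] := (sandwich_left hQ hf, sandwich_left hQ hh, sandwich_left hT hg).
have [[rf rh] rg] := (sandwich_right hP hf, sandwich_right hS hh, sandwich_right hS hg).
rewrite /deg0m /csum_to_psum /psum_to_csum /ctri /ptri /=.
case: (i == 0); rewrite ?mxunitE // !(mxblockE, mxunitE).
by rewrite lf lh lg rf rh rg.
Qed.

Lemma psumE P Q S T (f : pmor P Q) (g : pmor S T) : psumm f g = ptri f 0 g.
Proof. by []. Qed.

Lemma ptri_pmor P Q S T (f : pmor P Q) (h : pmor S Q) (g : pmor S T) :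
  is_pmor f -> is_pmor h -> is_pmor g -> is_pmor (ptri f h g).
Proof.
by rewrite /is_pmor => hf hh hg; rewrite /ptri /= !(mxblockE, mxunitE) -hf -hh -hg.
Qed.

Lemma rk_deg0_tri P Q S T (f : pmor P Q) (h : pmor S Q) (g : pmor S T) k :
  is_pobj P -> is_pobj Q -> is_pobj S -> is_pobj T ->
  is_pmor f -> is_pmor h -> is_pmor g ->
  rho (deg0m (ptri f h g)) k = rho (ctri (deg0m f) (deg0m h) (deg0m g)) k.
Proof.
move=> hP hQ hS hT hf hh hg.
have [[[cP cQ] cS] cT] := (deg0_cplx hP, deg0_cplx hQ, deg0_cplx hS, deg0_cplx hT).
apply: (rk_equiv rhoP (a := psum_to_csum P S) (b := csum_to_psum Q T)
  (a' := csum_to_psum P S) (b' := psum_to_csum Q T)).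
- exact: csum_cplx.
- exact: csum_cplx.
- exact: deg0_cplx (psum_pobj hP hS).
- exact: deg0_cplx (psum_pobj hQ hT).
- by apply: ctri_chain; apply: deg0m_chain.
- by apply: deg0m_chain; apply: ptri_pmor.
- exact: psum_to_csum_chain.
- exact: csum_to_psum_chain.
- exact: csum_to_psum_chain.
- exact: psum_to_csum_chain.
- by move=> i; case: (deg0m_ctri i hP hQ hS hT hf hh hg).
- by move=> i; case: (deg0m_ctri i hP hQ hS hT hf hh hg).
Qed.

Lemma pmor0 P Q : is_pmor (0 : pmor P Q).
Proof. by rewrite /is_pmor !mxunitE. Qed.

Lemma rk_deg0_sum P Q S T (f : pmor P Q) (g : pmor S T) k :
  is_pobj P -> is_pobj Q -> is_pobj S -> is_pobj T -> is_pmor f -> is_pmor g ->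
  rho (deg0m (psumm f g)) k = rho (deg0m f) k + rho (deg0m g) k.
Proof.
move=> hP hQ hS hT hf hg.
have [[[cP cQ] cS] cT] := (deg0_cplx hP, deg0_cplx hQ, deg0_cplx hS, deg0_cplx hT).
have [cf cg] := (deg0m_chain hf, deg0m_chain hg).
rewrite psumE rk_deg0_tri //; last exact: pmor0.
rewrite -(rk_sum rhoP) //.
have hc := csumm_chain cf cg.
apply: (rk_homotopic rhoP); try exact: csum_cplx;
  first exact: ctri_chain (deg0m_chain (pmor0 _ _)) _.
  exact: hc.
apply: eq_homotopic => i; rewrite /ctri /csumm; congr block_mx.
by rewrite /deg0m /=; case: (i == 0).
Qed.

Lemma rk_deg0_ut P Q S T (f : pmor P Q) (h : pmor S Q) (g : pmor S T) k :
  is_pobj P -> is_pobj Q -> is_pobj S -> is_pobj T ->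
  is_pmor f -> is_pmor h -> is_pmor g ->
  rho (deg0m f) k + rho (deg0m g) k <= rho (deg0m (ptri f h g)) k.
Proof.
move=> hP hQ hS hT hf hh hg; rewrite rk_deg0_tri //.
by apply: (rk_ut rhoP); try exact: deg0_cplx; exact: deg0m_chain.
Qed.

Lemma deg0m_pid P i : deg0m (pid P) i = cid (deg0 P) i.
Proof. by rewrite /deg0m /cid /=; case: (i == 0). Qed.

Lemma rk_deg0_pid P k : is_pobj P -> rho (deg0m (pid P)) k = rho (cid (deg0 P)) k.
Proof.
move=> hP; have cP := deg0_cplx hP.
have iP : is_pmor (pid P) by rewrite /is_pmor /pid !hP.
apply: (rk_homotopic rhoP) => //; first exact: deg0m_chain.
  exact: cid_chain.
exact: eq_homotopic (deg0m_pid _).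
Qed.

(** By additivity the free module of rank [n] has [n] times the rank of [A], so it vanishes in each
    coefficient where the constant 1 does. *)
Lemma rk_free n k : cst (R := R) d 1 k = 0 -> rho (deg0m (pid (freeobj A n))) k = 0.
Proof.
move=> k0; elim: n => [|n IHn].
  rewrite rk_deg0_pid; last exact: freeobjP.
  apply: (rk_zero rhoP); first by apply: deg0_cplx; exact: freeobjP.
  by move=> i /=; case: (i == 0) => //; apply: flatmx0.
have := rk_deg0_sum k (freeobjP A 1) (freeobjP A 1) (freeobjP A n) (freeobjP A n)
  (free_pmor (pid (freeobj A 1))) (free_pmor (pid (freeobj A n))).
rewrite IHn addr0 /psumm /pid /psum /= -!(scalar_mx_block _ _ 1) => ->.
have := rho1 k; rewrite k0 => <-.
exact: (rk_deg0_pid k (freeobjP A 1)).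
Qed.

(** A map out of [P] factors through the identity of a free module, whose rank is constant. As ranks
    are nonnegative, the nonconstant coefficients are squeezed to 0. *)
Lemma rk_deg0 P Q (f : pmor P Q) k : is_pobj P -> is_pobj Q -> is_pmor f ->
  rho (deg0m f) k = cst d (restr (@rho) f) k.
Proof.
move=> hP hQ hf; have [cP cQ] := (deg0_cplx hP, deg0_cplx hQ).
have ge0 : 0 <= rho (deg0m f) k by apply: (rk_ge0 rhoP) => //; exact: deg0m_chain.
have van : cst (R := R) d 1 k = 0 -> rho (deg0m f) k = 0.
  move=> k0; apply/eqP; rewrite eq_le ge0 andbT -(rk_free (pn P) k0).
  have hF := freeobjP A (pn P).
  apply: (rk_factor rhoP (a := deg0m (pe P : pmor P (freeobj A (pn P))))
    (b := deg0m (f : pmor (freeobj A (pn P)) Q))) => //.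
  - exact: deg0_cplx.
  - exact: deg0_cplx.
  - exact/deg0m_chain/free_pmor.
  - by apply: deg0m_chain; rewrite /is_pmor /= mul1mx hP.
  - by apply: deg0m_chain; rewrite /is_pmor /= mulmx1 (sandwich_left hQ hf).
  - by move=> i; rewrite -!deg0m_comp /pid /= mulmx1 (sandwich_right hP hf).
case: (rhoP) => /(_ _ _ _ cP cQ (deg0m_chain hf)) [per _] _.
rewrite /restr; case: d hd van per => [n|] /=; last first.
  by move=> _ van _; case: eqP => [->//|/eqP/negbTE k0]; apply: van; rewrite k0.
move=> n0 van per; case: ifP => [|k0]; last by apply: van; rewrite k0.
(* For finite [d], periodicity carries the coefficient at 0 to every multiple of [n]. *)
move/dvdzP => [z ->]; elim/int_rect: z => [|z IH|z IH]; first by rewrite mul0r.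
  by rewrite intS addrC mulrDl mul1r per.
by rewrite -per -IH; congr rho; rewrite -[n in _ + n]mul1r -mulrDl; lia.
Qed.

Lemma restr_sylvester : is_sylvester (restr (@rho)).
Proof.
split; [|split; [|split; [|split]]].
- move=> P Q f hP hQ hf; apply: (rk_ge0 rhoP); [exact: deg0_cplx..|exact: deg0m_chain].
- rewrite /restr (rk_deg0_pid _ (freeobjP A 1)) rho1.
  by rewrite /cst; case: d => [n|//]; rewrite dvdz0.
- by move=> *; apply: rk_deg0_sum.
- by move=> *; apply: rk_deg0_ut.
- by move=> *; apply: rk_deg0_comp.
Qed.

End DegreeZero.

(** * Truncations *)

Section Truncation.
Variable A : pzRingType.
Implicit Types X Y : cplx A.

(* Truncations keep the ambient ranks [cn X i] and kill the idempotents, which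
   avoids casts between matrix sizes. *)
Definition trim (b : pred int) X : cplx A :=
  Cplx (fun i => if b i then ce X i else 0)
       (fun i => if b i && b (i + 1) then cd X i else 0).
Definition at_deg (a : int) X := trim (fun i => i == a) X.
Definition above (a : int) X := trim (fun i => a < i) X.

Definition concentrated (a : int) X := forall i, i != a -> ce X i = 0.

Lemma trim_cplx b X : is_cplx X -> is_cplx (trim b X).
Proof.
move=> hX; split; [|split; [|split]] => [|i|i|i] /=; first by case: hX.
- by case: (b i); rewrite ?mxunitE ?cplx_idem.
- by case: (b i) (b (i + 1)) => [] []; rewrite /= ?mxunitE // cplx_ed // cplx_de.
- case: (b i) (b (i + 1)) (b (i + 1 + 1)) => [] [] [];
  by rewrite /= ?mxunitE ?cplx_dd.
Qed.

Lemma at_deg_concentrated a X : concentrated a (at_deg a X).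
Proof. by move=> i /negbTE /= ->. Qed.

Lemma concentrated_cd a X i : is_cplx X -> concentrated a X -> cd X i = 0.
Proof.
move=> hX cX; case: (eqVneq i a) => [->|/cX e0]; last first.
  by rewrite -(cplx_de hX) e0 mulmx0.
rewrite -(cplx_ed hX) cX ?mul0mx //; lia.
Qed.

Definition to_deg a X : cmor X (at_deg a X) := fun i => ce (at_deg a X) i.

(** The sign is that of the differential of [shift X]: when [X] vanishes below [a], the cone of this
    map is isomorphic to [shift X] by [split_in] and [split_out]. *)
Definition connect_deg a X : cmor (at_deg a X) (shift (above a X)) :=
  fun i => if i == a then - cd X i else 0.

Lemma connect_deg_chain a X : is_cplx X -> is_chain (connect_deg a X).
Proof.
move=> hX; apply: chainI => i; rewrite /connect_deg /=.
- case: (eqVneq i a) => [->|_]; rewrite ?mxunitE //.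
  by rewrite ltzD1 lexx cplx_ed.
- by case: (eqVneq i a) => _; rewrite ?mxunitE ?cplx_de.
- have -> : (i == a) && (i + 1 == a) = false by apply/negP; lia.
  rewrite mulmx0; case: (i == a); rewrite ?mxunitE //.
  by case: (_ && _); rewrite ?mxunitE ?cplx_dd.
Qed.

Section Split.
Variables (a : int) (X : cplx A).
Hypotheses (hX : is_cplx X) (low : forall i, i < a -> ce X i = 0).

Lemma to_deg_chain : is_chain (to_deg a X).
Proof.
apply: chainI => i; rewrite /to_deg /=.
- by case: (i == a); rewrite ?mxunitE ?cplx_idem.
- by case: (i == a); rewrite ?mxunitE ?cplx_idem.
- have -> : (i == a) && (i + 1 == a) = false by apply/negP; lia.
  rewrite mul0mx; case: eqP => h; rewrite ?mul0mx //.
  by rewrite -(cplx_de hX) [ce X i]low ?mxunitE //; lia.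
Qed.

Definition split_in : cmor (shift X) (cone (connect_deg a X)) :=
  fun i => col_mx (ce (at_deg a X) (i + 1)) (ce (above a X) (i + 1)).
Definition split_out : cmor (cone (connect_deg a X)) (shift X) :=
  fun i => row_mx (ce (at_deg a X) (i + 1)) (ce (above a X) (i + 1)).

Lemma split_in_chain : is_chain split_in.
Proof.
have cl i : i < a -> cd X i = 0 by move=> ia; rewrite -(cplx_de hX) low ?mulmx0.
apply: chainI => i; rewrite /split_in /connect_deg /= !(mxblockE, mxaddE, mxunitE);
  move: (i + 1) => j {i}.
- by case: (ltgtP j a) => /= _; rewrite ?mxunitE ?cplx_idem.
- by case: (ltgtP j a) => /= _; rewrite ?mxunitE ?cplx_idem.
- rewrite ltzD1; case: (ltgtP j a) => /= ja.
  + by rewrite cl // !mxunitE.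
  + have -> : (j + 1 == a) = false by apply/negP; lia.
    by rewrite !mxunitE cplx_ed ?cplx_de.
  + have -> : (j + 1 == a) = false by apply/negP; lia.
    by rewrite !mxunitE cplx_ed ?cplx_de.
Qed.

Lemma split_out_chain : is_chain split_out.
Proof.
have cl i : i < a -> cd X i = 0 by move=> ia; rewrite -(cplx_de hX) low ?mulmx0.
apply: chainI => i; rewrite /split_out /connect_deg /= !(mxblockE, mxaddE, mxunitE);
  move: (i + 1) => j {i}.
- by case: (ltgtP j a) => /= _; rewrite ?mxunitE ?cplx_idem.
- by case: (ltgtP j a) => /= _; rewrite ?mxunitE ?cplx_idem.
- rewrite ltzD1; case: (ltgtP j a) => /= ja.
  + by rewrite cl // !mxunitE.
  + have -> : (j + 1 == a) = false by apply/negP; lia.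
    by rewrite !mxunitE cplx_ed ?cplx_de.
  + have -> : (j + 1 == a) = false by apply/negP; lia.
    by rewrite !mxunitE cplx_ed ?cplx_de.
Qed.

Lemma split_inK i : split_out i *m split_in i = ce X (i + 1).
Proof.
rewrite /split_out /split_in /= !(mxblockE, mxunitE); move: (i + 1) => j {i}.
by case: (ltgtP j a) => /= [/low ->|_|_]; rewrite ?mxunitE ?cplx_idem.
Qed.

Lemma split_outK i : split_in i *m split_out i = ce (cone (connect_deg a X)) i.
Proof.
rewrite /split_out /split_in /= !(mxblockE, mxunitE); move: (i + 1) => j {i}.
by case: (ltgtP j a) => /= _; rewrite ?mxunitE ?cplx_idem.
Qed.

Variables (R : realType) (d : period) (rho : rankfun R A).
Hypothesis rhoP : is_rankfun d rho.
Arguments rho {X Y} _ _.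

Let hD := trim_cplx (fun i => i == a) hX.
Let hU := trim_cplx (fun i => a < i) hX.
Let hC := cone_cplx hD (shift_cplx hU) (connect_deg_chain a hX).

Lemma rk_cid_shift Y k : is_cplx Y -> rho (cid (shift Y)) k = rho (cid Y) (k - 1).
Proof. by move=> hY; rewrite -(rk_shift rhoP) //; apply: cid_chain. Qed.

Lemma rk_split k : rho (cid (cone (connect_deg a X))) k = rho (cid X) (k - 1).
Proof.
rewrite -rk_cid_shift //.
have [hi ho] := (split_in_chain, split_out_chain).
have hsX := shift_cplx hX.
apply: (rk_equiv rhoP (a := split_out) (b := split_in) (a' := split_in) (b' := split_out)) => //.
- exact: cid_chain.
- exact: cid_chain.
- by move=> i; rewrite (chain_er hsX hi) [RHS]split_outK.
- by move=> i; rewrite (chain_er hC ho) [RHS]split_inK.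
Qed.

(** Exactness at the cone of [connect_deg a X], which is [shift X]: the incoming map is bounded by
    its source, and the outgoing one factors through the shift of [to_deg a X]. The shift explains
    the passage to [k + 1]. *)
Lemma rk_devissage k : rho (cid X) k <= rho (cid (above a X)) k + rho (to_deg a X) k.
Proof.
have hd := connect_deg_chain a hX; have hsU := shift_cplx hU.
have hsD := shift_cplx hD; have ho := split_out_chain.
have hin := cone_in_chain (connect_deg a X) hsU.
have hout := cone_out_chain (connect_deg a X) hD.
have := rk_split (k + 1); rewrite addrK => <-.
rewrite -(rk_cone rhoP) //; apply: lerD.
  have := rk_le_dom rhoP (k + 1) hsU hC hin.
  by rewrite rk_cid_shift // addrK.
have := rk_shift rhoP (k + 1) hX hD to_deg_chain; rewrite addrK => <-.
apply: (rk_factor rhoP (a := split_out) (b := cid _)) => //.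
- exact: shift_cplx.
- exact: shiftm_chain to_deg_chain.
- exact: cid_chain.
- move=> i; rewrite /split_out /shiftm /to_deg /cid /cone_out /= !(mxblockE, mxunitE).
  by move: (i + 1) => j {i}; case: (ltgtP j a) => /= _; rewrite ?mxunitE ?cplx_idem.
Qed.

End Split.
End Truncation.

(** * Uniqueness *)

Section Concentrated.
Variable A : pzRingType.
Implicit Types X Y : cplx A.

(** Matching on the constructors of [int] makes [i == 0] compute in each branch, so the sizes agree
    by conversion. *)
Definition stalk_in X : cmor X (deg0 (Pobj (ce X 0))) :=
  fun i => match i with Posz 0 => ce X 0 | _ => 0 end.
Definition stalk_out X : cmor (deg0 (Pobj (ce X 0))) X :=
  fun i => match i with Posz 0 => ce X 0 | _ => 0 end.

Lemma stalk_in_chain X : is_cplx X -> concentrated 0 X -> is_chain (stalk_in X).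
Proof.
move=> hX cX; apply: chainI => i; last by rewrite (concentrated_cd _ hX cX) mulmx0 mul0mx.
  by case: i => [[|i]|i]; rewrite /stalk_in /= ?mxunitE ?cplx_idem.
by case: i => [[|i]|i]; rewrite /stalk_in /= ?mxunitE ?cplx_idem.
Qed.

Lemma stalk_out_chain X : is_cplx X -> concentrated 0 X -> is_chain (stalk_out X).
Proof.
move=> hX cX; apply: chainI => i; last by rewrite (concentrated_cd _ hX cX) mulmx0 mul0mx.
  by case: i => [[|i]|i]; rewrite /stalk_out /= ?mxunitE ?cplx_idem.
by case: i => [[|i]|i]; rewrite /stalk_out /= ?mxunitE ?cplx_idem.
Qed.

(* Only used for concentrated complexes, whose differentials vanish. *)
Definition unshift X : cplx A :=
  Cplx (cn := fun i => cn X (i - 1)) (fun i => ce X (i - 1)) (fun=> 0).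
Definition unshiftm X Y (f : cmor X Y) : cmor (unshift X) (unshift Y) :=
  fun i => f (i - 1).

(* Transport along [i = j] without a cast: [pid_mx] is then the identity. *)
Definition regrade X i j : 'M[A]_(cn X i, cn X j) := pid_mx (cn X j).

Lemma regrade_natural X Y (f : cmor X Y) i j : i = j ->
  regrade Y i j *m f j = f i *m regrade X i j.
Proof. by move=> ->; rewrite /regrade !pid_mx_1 mulmx1 mul1mx. Qed.

Lemma regrade_ce X i j : i = j -> regrade X i j *m ce X j = ce X i *m regrade X i j.
Proof. exact: (regrade_natural (cid X)). Qed.

Lemma regradeK X i j : i = j -> regrade X i j *m regrade X j i = 1%:M.
Proof. by move=> ->; rewrite /regrade !pid_mx_1 mulmx1. Qed.

Lemma unshift_cplx X : is_cplx X -> is_cplx (unshift X).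
Proof.
move=> hX; split; [|split; [|split]] => [|i|i|i] /=; rewrite ?mxunitE ?cplx_idem //.
by case: hX => [[N hN] _]; exists N.+1 => i hi; apply: hN; lia.
Qed.

Lemma unshiftm_chain X Y (f : cmor X Y) : is_chain f -> is_chain (unshiftm f).
Proof. by case=> hf _; split=> i; rewrite /= ?mxunitE ?hf. Qed.

Definition reshift_in X : cmor X (shift (unshift X)) :=
  fun i => regrade X (i + 1 - 1) i *m ce X i.
Definition reshift_out X : cmor (shift (unshift X)) X :=
  fun i => ce X i *m regrade X i (i + 1 - 1).

Lemma reshift_in_chain a X : is_cplx X -> concentrated a X -> is_chain (reshift_in X).
Proof.
move=> hX cX; have e i : i + 1 - 1 = i :> int by rewrite addrK.
apply: chainI => i; rewrite /reshift_in /=.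
- by rewrite (regrade_ce X (e i)) mulmxA cplx_idem.
- by rewrite -mulmxA cplx_idem.
- by rewrite (concentrated_cd _ hX cX) !mxunitE.
Qed.

Lemma reshift_out_chain a X : is_cplx X -> concentrated a X -> is_chain (reshift_out X).
Proof.
move=> hX cX; have e i : i = i + 1 - 1 :> int by rewrite addrK.
apply: chainI => i; rewrite /reshift_out /=.
- by rewrite mulmxA cplx_idem.
- by rewrite -(regrade_ce X (e i)) -mulmxA cplx_idem.
- by rewrite (concentrated_cd _ hX cX) !mxunitE.
Qed.

Lemma bounded X : is_cplx X ->
  exists (a : int) (n : nat), forall i, ~~ (a <= i < a + n%:Z) -> ce X i = 0.
Proof.
(* The degrees from [- N] to [N] number [N + N + 1]. *)
move=> [[N hN] _]; exists (- N%:Z), (N + N).+1 => i hi.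
have : cn X i = 0%N by apply: hN; lia.
by move: (ce X i) => e n0; move: e; rewrite n0 => e; apply: flatmx0.
Qed.

End Concentrated.

(** * Normalized rank functions with Laurent polynomial values *)

Section LaurentRank.
Variables (R : realType) (A : pzRingType) (rho : rankfun R A).
Hypotheses (rhoP : is_rankfun Infty rho) (rho1 : normalized Infty rho).
Arguments rho {X Y} _ _.
Implicit Types X Y : cplx A.

(** Degree 0 is [rk_deg0]. Shifting reaches every other degree: it lowers the degree by one and
    multiplies by [q], so degree [a] contributes to the power [- a]. *)
Lemma rk_concentrated a X Y (f : cmor X Y) k :
  is_cplx X -> is_cplx Y -> concentrated a X -> concentrated a Y -> is_chain f ->
  rho f k = if k == - a then
    restr (@rho) (f a : pmor (Pobj (ce X a)) (Pobj (ce Y a))) else 0.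
Proof.
(* The induction on the degree replaces the complexes by their shifts, so the claim quantifies over
   them. *)
pose claim (b : int) := forall X Y (f : cmor X Y) k,
    is_cplx X -> is_cplx Y -> concentrated b X -> concentrated b Y -> is_chain f ->
    rho f k = if k == - b then
      restr (@rho) (f b : pmor (Pobj (ce X b)) (Pobj (ce Y b))) else 0.
have step b : claim b -> claim (b + 1).
  move=> {X Y f k} IH X Y f k hX hY cX cY hf.
  have := rk_shift rhoP (k + 1) hX hY hf; rewrite addrK => <-.
  rewrite (IH (shift X)); [|exact: shift_cplx..| | |exact: shiftm_chain].
  - by have -> : (k + 1 == - b) = (k == - (b + 1)) by lia.
  - by move=> i ib; apply: cX; lia.
  - by move=> i ib; apply: cY; lia.
have unstep b : claim b -> claim (b - 1).
  move=> {X Y f k} IH X Y f k hX hY cX cY hf.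
  have [hX' hY'] := (unshift_cplx hX, unshift_cplx hY); have hf' := unshiftm_chain hf.
  have -> : rho f k = rho (shiftm (unshiftm f)) k.
    have e i : i = i + 1 - 1 :> int by rewrite addrK.
    have fl := chain_el hY hf; have fr := chain_er hX hf.
    apply: (rk_equiv rhoP (a := reshift_in X) (b := reshift_out Y)
      (a' := reshift_out X) (b' := reshift_in Y)) => //.
    - exact: shift_cplx.
    - exact: shift_cplx.
    - exact: shiftm_chain.
    - exact: reshift_in_chain cX.
    - exact: reshift_out_chain cY.
    - exact: reshift_out_chain cX.
    - exact: reshift_in_chain cY.
    - move=> i; rewrite /reshift_in /reshift_out /shiftm /unshiftm /=.
      rewrite -[_ *m f _]mulmxA (regrade_natural f (e i)) !mulmxA fl.
      by rewrite -[f i *m _ *m _]mulmxA regradeK // mulmx1 fr.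
    - move=> i; rewrite /reshift_in /reshift_out /shiftm /unshiftm /=.
      rewrite -[_ *m ce Y _ *m _]mulmxA fl (regrade_natural f (esym (e i))).
      by rewrite mulmxA -[f _ *m _ *m ce X _]mulmxA (regrade_ce X (esym (e i)))
        mulmxA fr -mulmxA regradeK ?mulmx1.
  rewrite (rk_shift rhoP) // (IH (unshift X)) //.
  - by have -> : (k - 1 == - b) = (k == - (b - 1)) by lia.
  - by move=> i ib; apply: cX; lia.
  - by move=> i ib; apply: cY; lia.
suff: claim a by apply.
elim/int_rect: a => [|n IH|n IH].
- move=> {X Y f k} X Y f k hX hY cX cY hf.
  have oX : is_pobj (Pobj (ce X 0)) := cplx_idem hX 0.
  have oY : is_pobj (Pobj (ce Y 0)) := cplx_idem hY 0.
  have hf0 : @is_pmor _ (Pobj (ce X 0)) (Pobj (ce Y 0)) (f 0) by case: hf => hf _; apply: hf.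
  have := rk_deg0 (d := Infty) I rhoP rho1 k oX oY hf0; rewrite /= oppr0 => <-.
  have fl := chain_el hY hf; have fr := chain_er hX hf.
  apply: (rk_equiv rhoP (a := stalk_in X) (b := stalk_out Y)
      (a' := stalk_out X) (b' := stalk_in Y)) => //.
  - exact: deg0_cplx.
  - exact: deg0_cplx.
  - exact: deg0m_chain.
  - exact: stalk_in_chain.
  - exact: stalk_out_chain.
  - exact: stalk_out_chain.
  - exact: stalk_in_chain.
  - case=> [[|i]|i]; rewrite /stalk_in /stalk_out /deg0m /= ?fl ?fr //.
      by rewrite mulmx0 -fl cY // mul0mx.
    by rewrite mulmx0 -fl cY // mul0mx.
  - by case=> [[|i]|i]; rewrite /stalk_in /stalk_out /deg0m /= ?fl ?fr // mul0mx mul0mx.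
- have -> : n.+1%:Z = n%:Z + 1 by lia.
  exact: step.
- have -> : - n.+1%:Z = - n%:Z - 1 by lia.
  exact: unstep.
Qed.

(** The alternating sum of exactness at [Y], at the cone and at [shift X], in which [cone_in f] and
    [cone_out f] cancel. *)
Lemma rk_euler X Y (f : cmor X Y) k : is_cplx X -> is_cplx Y -> is_chain f ->
  rho f k + rho f (k - 1) =
  rho (cid Y) k - rho (cid (cone f)) k + rho (cid X) (k - 1).
Proof.
move=> hX hY hf; have := rk_cone_in rhoP k hX hY hf.
by have := rk_cone rhoP k hX hY hf; have := rk_cone_out rhoP k hX hY hf; lra.
Qed.

(** Induction on the number of degrees, splitting off the lowest: degree [b] contributes only to the
    coefficient [- b], and here [b >= a]. *)
Lemma rk_support n a X k : is_cplx X ->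
  (forall i, ~~ (a <= i < a + n%:Z) -> ce X i = 0) -> - a < k -> rho (cid X) k = 0.
Proof.
elim: n a X k => [|n IH] a X k hX bX ak.
  by apply: (rk_zero rhoP) => // i; apply: bX; lia.
have low i : i < a -> ce X i = 0 by move=> ia; apply: bX; lia.
have hD : is_cplx (at_deg a X) by apply: trim_cplx.
have hU : is_cplx (above a X) by apply: trim_cplx.
apply/eqP; rewrite eq_le (rk_ge0 rhoP) ?andbT //; last exact: cid_chain.
apply: le_trans (rk_devissage hX low rhoP k) _.
rewrite (IH (a + 1)) //; last by lia.
  rewrite add0r; apply: le_trans (rk_le_cod rhoP k hX hD (to_deg_chain hX low)) _.
  rewrite (rk_concentrated (a := a)) //; try exact: at_deg_concentrated; last exact: cid_chain.
  by case: eqP => // ka; exfalso; lia.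
by move=> i hi /=; case: ifP => // ai; apply: bX; lia.
Qed.

(** Up to sign this is the differential out of degree [a], as a map between complexes concentrated
    in that degree, where [rk_concentrated] applies. *)
Definition connect_stalk a X : cmor (at_deg a X) (at_deg a (shift (above a X))) :=
  ccomp (to_deg a (shift (above a X))) (connect_deg a X).

Lemma connect_stalk_chain a X : is_cplx X -> is_chain (connect_stalk a X).
Proof.
move=> hX; have hsU := shift_cplx (trim_cplx (fun i => a < i) hX).
apply: ccomp_chain (connect_deg_chain a hX) _; try exact: trim_cplx.
apply: to_deg_chain => // i ia /=; case: ifP => // ai; exfalso; lia.
Qed.

(** Away from [k = - a] both ranks vanish, the source being concentrated in degree [a]. At
    [k = - a], let [Y] be the target of [connect_deg a X]. Frobenius' inequality bounds the loss
    under projection to degree [a] by the rank of [Y] minus that of the projection. By dévissage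
    this is at most the rank of [above a Y], which is 0 there because that complex starts in degree
    [a + 1]. *)
Lemma rk_connect a n X k : is_cplx X ->
  (forall i, ~~ (a <= i < a + n%:Z) -> ce X i = 0) ->
  rho (connect_deg a X) k = rho (connect_stalk a X) k.
Proof.
move=> hX bX; have hU : is_cplx (above a X) by apply: trim_cplx.
have hD : is_cplx (at_deg a X) by apply: trim_cplx.
have hY := shift_cplx hU; have hd := connect_deg_chain a hX.
have hYD : is_cplx (at_deg a (shift (above a X))) by apply: trim_cplx.
have hYU : is_cplx (above a (shift (above a X))) by apply: trim_cplx.
have low i : i < a -> ce (shift (above a X)) i = 0.
  by move=> ia /=; case: ifP => // ai; exfalso; lia.
have ht := to_deg_chain hY low.
have cle := rk_compl rhoP k hD hY hYD hd ht.
apply/eqP; rewrite eq_le [X in _ && X]cle andbT.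
case: (eqVneq k (- a)) => [ka|ka]; last first.
  apply: le_trans (rk_le_dom rhoP k hD hY hd) _.
  rewrite (rk_concentrated (a := a)) //; try exact: at_deg_concentrated; last exact: cid_chain.
  by rewrite (negbTE ka); apply: (rk_ge0 rhoP) => //; apply: connect_stalk_chain.
have := rk_frobenius rhoP k hD hY hYD hd ht.
have := rk_devissage hY low rhoP k.
rewrite (rk_support (n := n) (a := a + 1) hYU) //; first by rewrite /connect_stalk; lra.
  move=> i hi /=; case: ifP => // ai; case: ifP => // ai'; apply: bX; lia.
lia.
Qed.

End LaurentRank.

(** Induction on the number of degrees. [rk_euler] for the connecting map expresses the rank of its
    cone, [shift X], by the ranks of the lowest term, of the rest and of the connecting map; the
    first and last are concentrated cases. *)
Lemma rk_unique_cid (R : realType) (A : pzRingType) (rho1 rho2 : rankfun R A) :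
  is_rankfun Infty rho1 -> normalized Infty rho1 ->
  is_rankfun Infty rho2 -> normalized Infty rho2 ->
  (forall (P Q : pobj A) (m : pmor P Q), is_pobj P -> is_pobj Q -> is_pmor m ->
      restr rho1 m = restr rho2 m) ->
  forall X k, is_cplx X -> rho1 _ _ (cid X) k = rho2 _ _ (cid X) k.
Proof.
move=> r1 n1 r2 n2 e X k hX; have [a [n bX]] := bounded hX.
have conc b Y Z (f : cmor Y Z) j : is_cplx Y -> is_cplx Z -> concentrated b Y ->
    concentrated b Z -> is_chain f -> rho1 _ _ f j = rho2 _ _ f j.
  move=> hY hZ cY cZ hf; rewrite (rk_concentrated r1 n1 _ hY hZ cY cZ hf).
  rewrite (rk_concentrated r2 n2 _ hY hZ cY cZ hf) e //.
  - exact: (cplx_idem hY b).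
  - exact: (cplx_idem hZ b).
  - by case: hf => hf _; apply: hf.
elim: n a X k hX bX => [|n IH] a X k hX bX.
  have e0 i : ce X i = 0 by apply: bX; lia.
  by rewrite (rk_zero r1) // (rk_zero r2).
have low i : i < a -> ce X i = 0 by move=> ia; apply: bX; lia.
have hD : is_cplx (at_deg a X) by apply: trim_cplx.
have hU : is_cplx (above a X) by apply: trim_cplx.
have eU j : rho1 _ _ (cid (above a X)) j = rho2 _ _ (cid (above a X)) j.
  apply: (IH (a + 1)) => // i hi /=; case: ifP => // ai; apply: bX; lia.
have eD j : rho1 _ _ (cid (at_deg a X)) j = rho2 _ _ (cid (at_deg a X)) j.
  by apply: (conc a) => //; [exact: at_deg_concentrated..|exact: cid_chain].
have hsU := shift_cplx hU; have hd := connect_deg_chain a hX.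
have ed j : rho1 _ _ (connect_deg a X) j = rho2 _ _ (connect_deg a X) j.
  rewrite (rk_connect r1 n1 _ hX bX) (rk_connect r2 n2 _ hX bX).
  by apply: (conc a) => //; [exact: trim_cplx|exact: at_deg_concentrated..|
    exact: connect_stalk_chain].
have := rk_split hX low r1 (k + 1); have := rk_split hX low r2 (k + 1).
have := rk_euler r1 (k + 1) hD hsU hd; have := rk_euler r2 (k + 1) hD hsU hd.
rewrite !addrK !ed (rk_cid_shift r1) // (rk_cid_shift r2) // !addrK eU eD; lra.
Qed.

(** Given agreement on objects, [rk_euler] propagates agreement on [f] from [k - 1] to [k]. It
    starts far below, where both ranks vanish; this is the injectivity of [1 + q]. *)
Lemma rk_unique (R : realType) (A : pzRingType) (rho1 rho2 : rankfun R A) :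
  is_rankfun Infty rho1 -> normalized Infty rho1 ->
  is_rankfun Infty rho2 -> normalized Infty rho2 ->
  (forall (P Q : pobj A) (m : pmor P Q), is_pobj P -> is_pobj Q -> is_pmor m ->
      restr rho1 m = restr rho2 m) ->
  forall X Y (f : cmor X Y), is_cplx X -> is_cplx Y -> is_chain f ->
  rho1 _ _ f =1 rho2 _ _ f.
Proof.
move=> r1 n1 r2 n2 e X Y f hX hY hf.
have eid Z k : is_cplx Z -> rho1 _ _ (cid Z) k = rho2 _ _ (cid Z) k.
  exact: rk_unique_cid.
have hC := cone_cplx hX hY hf.
have step k : rho1 _ _ f (k - 1) = rho2 _ _ f (k - 1) -> rho1 _ _ f k = rho2 _ _ f k.
  have := rk_euler r1 k hX hY hf; have := rk_euler r2 k hX hY hf.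
  by rewrite !eid //; lra.
case: (r1) (r2) => /(_ _ _ f hX hY hf) [[N1 b1] _] _ [/(_ _ _ f hX hY hf) [[N2 b2] _] _].
have low k : k < - (N1 + N2)%:Z -> rho1 _ _ f k = rho2 _ _ f k.
  by move=> hk; rewrite b1 ?b2 //; lia.
move=> k; case: (ltP k (- (N1 + N2)%:Z)) => [/low //|hk].
have [m ->] : exists m : nat, k = m%:Z - (N1 + N2)%:Z - 1.
  (* Steps are counted from the largest coefficient covered by [low]. *)
  by exists (absz (k + (N1 + N2)%:Z + 1)); lia.
elim: m => [|m IH]; first by apply: low; lia.
by apply: step; have -> : m.+1%:Z - (N1 + N2)%:Z - 1 - 1 = m%:Z - (N1 + N2)%:Z - 1 by lia.
Qed.

Theorem theorem3p7 (R : realType) (A : pzRingType) :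
  (forall (d : period) (rho : rankfun R A),
      valid_period d -> is_rankfun d rho -> normalized d rho ->
      (forall (P Q : pobj A) (m : pmor P Q), is_pobj P -> is_pobj Q -> is_pmor m ->
          0 <= restr rho m /\ rho _ _ (deg0m m) =1 cst d (restr rho m)) /\
      is_sylvester (restr rho)) /\
  (forall rho1 rho2 : rankfun R A,
      is_rankfun Infty rho1 -> normalized Infty rho1 ->
      is_rankfun Infty rho2 -> normalized Infty rho2 ->
      (forall (P Q : pobj A) (m : pmor P Q), is_pobj P -> is_pobj Q -> is_pmor m ->
          restr rho1 m = restr rho2 m) ->
      forall (X Y : cplx A) (f : cmor X Y), is_cplx X -> is_cplx Y -> is_chain f ->
        rho1 X Y f =1 rho2 X Y f) /\
  (forall s : sylrank R A, is_sylvester s ->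
      exists rho : rankfun R A,
        is_rankfun Infty rho /\ normalized Infty rho /\
        forall (P Q : pobj A) (m : pmor P Q), is_pobj P -> is_pobj Q -> is_pmor m ->
          restr rho m = s P Q m).
Proof.
split; [|split].
- move=> d rho hd rhoP rho1; have sS := restr_sylvester rhoP rho1.
  split=> // P Q m hP hQ hm; split; first by case: sS => s0 _; apply: s0.
  by move=> k; apply: rk_deg0.
- move=> rho1 rho2 r1 n1 r2 n2 e X Y f; exact: rk_unique.
- move=> s sS; have rP := mxrank_ofP sS; exists (mx_rankfun (mxrank_of s)).
  split; [exact: mx_rankfunP|split] => [k|P Q m hP hQ hm].
    (* The differentials of [deg0] vanish, so only the rank of the idempotent remains. *)
    rewrite /mx_rankfun cohrank_id //; last exact: deg0_cplx (freeobjP A 1).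
    rewrite /= !(mxrank0 rP) !subr0 subrK oppr_eq0; case: (k == 0).
      by case: rP.
    exact: mxrank0.
  by rewrite /restr mx_rankfun_deg0 // (mxrank_ofE sS).
Qed.
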